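(* For every $K>0$ there exist constants $c_1,c_2>0$ (depending only on $K$) such that the following holds. If $A\subseteq\mathbb{Z}$ is a finite set with $|A+A|\le K|A|$, then there exist a subset $A'\subseteq A$ with $|A'|\ge c_1|A|$ and an order-preserving Freiman 2-isomorphism $\phi:A'\to[-c_2|A'|,\,c_2|A'|]\cap\mathbb{Z}$.
   Context: The sumset is $A+B:=\{a+b: a\in A,\ b\in B\}$. For $X\subseteq\mathbb{Z}$, a map $\phi:X\to\mathbb{R}$ is an order-preserving Freiman 2-isomorphism (onto its image) if for all $a,b,c,d\in X$: (i) $\phi(a)<\phi(b)$ if and only if $a<b$; and (ii) $\phi(a)+\phi(b)=\phi(c)+\phi(d)$ if and only if $a+b=c+d$. The notation $\phi:A'\to[-c_2|A'|,c_2|A'|]\cap\mathbb{Z}$ means only that $\phi$ takes values in that set; surjectivity is not required. *)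

(* Defs.v *)
From HB Require Import structures.
From mathcomp Require Import all_boot all_order all_algebra.
From mathcomp Require Import finmap reals.

Set Implicit Arguments.
Unset Strict Implicit.
Unset Printing Implicit Defensive.

Import Order.TTheory GRing.Theory Num.Theory.
Local Open Scope ring_scope.

Definition sumset (A B : {fset int}) : {fset int} :=
  [fset (a + b)%R | a in A, b in B]%fset.

(* phi is a map on X extended by arbitrary values to all of int: only its
   values on X are constrained. *)
Definition order_preserving_freiman2_iso
    (R : realType) (X : {pred int}) (phi : int -> R) : Prop :=
  {in X &, forall a b, phi a < phi b <-> a < b} /\
  (forall a b c d, a \in X -> b \in X -> c \in X -> d \in X ->
     phi a + phi b = phi c + phi d <-> a + b = c + d).

(* Main.v *)
Require Import Defs.
From HB Require Import structures.
From mathcomp Require Import all_boot all_order all_algebra.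
From mathcomp Require Import finmap reals.
From mathcomp Require Import perm zify ring lra boolp trigo.

(* By Plünnecke's inequality and Ruzsa's model lemma, a positive proportion of
   [A] is Freiman 6-isomorphic to a dense subset of Z/N with N = O(|A|), and by
   Bogolyubov's lemma a Bohr set of bounded rank lifts to a subset of [2A - 2A];
   a translate of a smaller Bohr set then captures a positive proportion of [A].
   Describe the Bohr set as the points of a lattice Z^d in a box.  The lifting
   map [P] to Z is locally additive, hence linear on a smaller box, and the
   integer order is the sign of this linear form.  The linear forms that are at
   least 1 on all the points where [P] is positive make up a polyhedron; a vertex
   of it is given by Cramer's rule, and after clearing denominators its values
   are sums of determinants of points of the box, which the volume of the box
   bounds by O(N).  This vertex is the required order-preserving map. *)

Set Implicit Arguments.
Unset Strict Implicit.
Unset Printing Implicit Defensive.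

Import Order.TTheory GRing.Theory Num.Theory.
Local Open Scope fset_scope.
Local Open Scope ring_scope.

(** * Sumsets *)

(** The model in Z/N forgets the order of Z, so the order has to be recovered from [P], whose values
    in Z may be arbitrarily large. Only the signs of [P] at differences of points matter, and the
    aim is to replace [P] by a linear form with the same signs and small values. Positivity alone
    cuts out an open cone, without a vertex to solve for; asking for values at least 1 gives a
    polyhedron whose vertices solve square systems with right-hand side 1. Smallness comes from the
    shape of the lattice: for g frequencies it has rank d = g + 1 and determinant N^(d-1), and its
    box has radius at most N, so the coordinate determinant of d points of the box is at most d! N^d
    / N^(d-1) = d! N. The order 6 of the Freiman isomorphism arises because a value of [P] is a1 +
    a2 - (a3 + a4) with all ai in the model set, and P(c + c') = P(c) + P(c') then compares two sums
    of six elements. *)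

Lemma sumsetP (A B : {fset int}) x :
  reflect (exists2 a, a \in A & exists2 b, b \in B & x = a + b) (x \in sumset A B).
Proof.
by apply: (iffP (imfset2P _ _ _ _ _)) => -[a aA [b bB ->]]; exists a => //; exists b.
Qed.

Lemma mem_sumset (A B : {fset int}) a b : a \in A -> b \in B -> a + b \in sumset A B.
Proof. by move=> aA bB; apply/sumsetP; exists a => //; exists b. Qed.

Lemma sumsetC A B : sumset A B = sumset B A.
Proof.
apply/fsetP => x.
by apply/sumsetP/sumsetP => -[a aA [b bB ->]]; exists b => //; exists a => //; rewrite addrC.
Qed.

Lemma sumsetA A B C : sumset A (sumset B C) = sumset (sumset A B) C.
Proof.
apply/fsetP => x; apply/sumsetP/sumsetP.
  move=> [a aA [_ /sumsetP[b bB [c cC ->]] ->]].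
  by exists (a + b); [exact: mem_sumset|exists c => //; rewrite addrA].
move=> [_ /sumsetP[a aA [b bB ->]] [c cC ->]].
by exists a => //; exists (b + c); [exact: mem_sumset|rewrite addrA].
Qed.

Lemma sumset0 A : sumset A [fset 0] = A.
Proof.
apply/fsetP => x; apply/sumsetP/idP => [[a aA [b]]|xA].
  by rewrite inE => /eqP -> ->; rewrite addr0.
by exists x => //; exists 0; rewrite ?inE ?addr0.
Qed.

Lemma sumset_subset A A' B B' : A `<=` A' -> B `<=` B' -> sumset A B `<=` sumset A' B'.
Proof.
move=> sA sB; apply/fsubsetP => x /sumsetP[a aA [b bB ->]].
by apply: mem_sumset; [exact: (fsubsetP sA)|exact: (fsubsetP sB)].
Qed.

Lemma card_sumset1 c A : #|` sumset [fset c] A| = #|` A|.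
Proof.
have -> : sumset [fset c] A = [fset c + a | a in A].
  apply/fsetP => x; apply/sumsetP/imfsetP => [[b]|[a /= aA ->]].
    by rewrite inE => /eqP -> [a aA ->]; exists a.
  by exists c; [rewrite inE|exists a].
by rewrite card_imfset //=; apply: addrI.
Qed.

Definition oppset (A : {fset int}) : {fset int} := [fset - a | a in A].

Lemma mem_oppset A x : (x \in oppset A) = (- x \in A).
Proof.
apply/imfsetP/idP => [[a /= aA ->]|xA]; first by rewrite opprK.
by exists (- x); rewrite ?opprK.
Qed.

(* [X] minimises the ratio [|X + A| / |X|]. *)
Lemma petridis (A : {fset int}) : A != fset0 ->
  exists X : {fset int}, [/\ X `<=` A, X != fset0,
    (#|` sumset X A| * #|` A| <= #|` sumset A A| * #|` X|)%N &
    forall C, (#|` sumset C (sumset X A)| * #|` X| <= #|` sumset X A| * #|` sumset C X|)%N].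
Proof.
move=> A0; have [X [XA X0 Xmin]] : exists X, [/\ X `<=` A, X != fset0 &
    forall Z, Z `<=` A -> Z != fset0 ->
      (#|` sumset X A| * #|` Z| <= #|` sumset Z A| * #|` X|)%N].
  pose r (Z : {fset int}) : rat := #|` sumset Z A|%:R / #|` Z|%:R.
  pose Ps := [fset Z in fpowerset A | Z != fset0].
  have APs : A \in Ps by rewrite !inE /= A0 fpowersetE fsubset_refl.
  have := @Order.TotalTheory.arg_minP _ rat Ps [` APs] xpredT (fun Z => r (fsval Z)) isT.
  case=> X _ Xmin.
  have := fsvalP X; rewrite !inE fpowersetE => /andP[XA X0].
  exists (fsval X); split=> // Z ZA Z0.
  have ZPs : Z \in Ps by rewrite !inE /= Z0 fpowersetE ZA.
  have := Xmin [` ZPs] isT; rewrite /r /= ler_pdivrMr ?ltr0n ?cardfs_gt0 //.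
  by rewrite mulrAC ler_pdivlMr ?ltr0n ?cardfs_gt0 // -!natrM ler_nat.
exists X; split=> //; first exact: Xmin.
have Xmin' Z : Z `<=` X -> (#|` sumset X A| * #|` Z| <= #|` sumset Z A| * #|` X|)%N.
  move=> ZX; have [->|Z0] := eqVneq Z fset0; first by rewrite cardfs0 muln0.
  by apply: Xmin => //; apply: fsubset_trans XA.
elim/fset1U_rect => [|c C cC IH].
  have -> B : sumset fset0 B = fset0.
    by apply/fsetP => x; rewrite inE; apply/negP => /sumsetP[a]; rewrite inE.
  by rewrite cardfs0.
have sumU B : sumset (c |` C) B = sumset C B `|` sumset [fset c] B.
  apply/fsetP => x; rewrite inE; apply/sumsetP/orP => [[a /fset1UP[->|aC] [b bB ->]]|].
  - by right; apply: mem_sumset; rewrite ?inE.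
  - by left; apply: mem_sumset.
  case=> /sumsetP[a aC [b bB ->]]; exists a; try by exists b.
    by rewrite !inE aC orbT.
  by move: aC; rewrite !inE => ->.
(* For x in [Z] the translate c + x + A brings nothing new, so adding [c] to [C] enlarges C + X + A
   by at most |X + A| - |Z + A|. By minimality this is at most |X + A| (|X| - |Z|) / |X|, while C +
   X grows by exactly |X| - |W|, and [W] is contained in [Z]. *)
pose Z := [fset x in X | sumset [fset c + x] A `<=` sumset C (sumset X A)].
pose W := [fset x in X | c + x \in sumset C X].
have WZ : W `<=` Z.
  apply/fsubsetP => x; rewrite !inE => /andP[-> /= cx]; rewrite sumsetA.
  by apply: sumset_subset => //; rewrite fsub1set.
have ZX : Z `<=` X by apply/fsubsetP => x; rewrite !inE => /andP[].
have h1 : (#|` sumset (c |` C) (sumset X A)| + #|` sumset Z A| <=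
    #|` sumset C (sumset X A)| + #|` sumset X A|)%N.
  rewrite sumU cardfsU card_sumset1.
  have : (#|` sumset Z A| <= #|` sumset C (sumset X A) `&` sumset [fset c] (sumset X A)|)%N.
    rewrite -(card_sumset1 c); apply: fsubset_leq_card; apply/fsubsetP => t /sumsetP[c'].
    rewrite inE => /eqP -> [_ /sumsetP[z zZ [a aA ->]] ->].
    move: zZ; rewrite !inE /= => /andP[zX zC].
    rewrite addrA; apply/andP; split.
      by apply: (fsubsetP zC); apply: mem_sumset; rewrite ?inE.
    by rewrite -addrA; apply: mem_sumset; rewrite ?inE // mem_sumset.
  have : (#|` sumset C (sumset X A) `&` sumset [fset c] (sumset X A)| <=
    #|` sumset C (sumset X A)|)%N.
    by apply: fsubset_leq_card; apply: fsubsetIl.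
  lia.
have h2 : #|` sumset (c |` C) X| = (#|` sumset C X| + #|` X| - #|` W|)%N.
  rewrite sumU cardfsU card_sumset1; congr (_ - _)%N.
  rewrite -(card_sumset1 c W); congr #|` _|; apply/fsetP => x; rewrite inE.
  apply/andP/sumsetP => [[h /sumsetP[c']]|[c']].
    rewrite inE => /eqP -> [y yX e]; exists c; rewrite ?inE //; exists y => //.
    by rewrite !inE yX -e.
  rewrite inE => /eqP -> [y]; rewrite !inE /= => /andP[yX h] ->; split=> //.
  by apply: mem_sumset; rewrite ?inE.
have := Xmin' Z ZX; have := fsubset_leq_card WZ; have := fsubset_leq_card ZX.
rewrite h2; move: h1 IH.
set a := #|` sumset X A|; set b := #|` X|; set z := #|` Z|; set za := #|` sumset Z A|.
move: #|` W| #|` sumset C X| #|` sumset _ _| #|` sumset _ _| => w cx c1 c2.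
nia.
Qed.

Fixpoint nsum (n : nat) (A : {fset int}) : {fset int} :=
  if n is n'.+1 then sumset A (nsum n' A) else [fset 0].

Lemma mem_nsum (A : {fset int}) (s : seq int) :
  {subset s <= A} -> \sum_(x <- s) x \in nsum (size s) A.
Proof.
elim: s => [|x s IHs] /= sA; first by rewrite big_nil inE.
rewrite big_cons; apply: mem_sumset; first by apply: sA; rewrite mem_head.
by apply: IHs => y ys; apply: sA; rewrite inE ys orbT.
Qed.

(** Fix for each difference d a representation d = b - c. Then (x, d) is recovered from (x + b, x +
    c): the difference of the two entries is d, which determines b and c, and then x. *)
Lemma ruzsa_triangle (X B C : {fset int}) :
  (#|` X| * #|` sumset B (oppset C)| <= #|` sumset X B| * #|` sumset X C|)%N.
Proof.
pose D := sumset B (oppset C).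
have repr (d : D) : exists p : int * int, [&& p.1 \in B, p.2 \in C & val d == p.1 - p.2].
  have /sumsetP[b bB [c]] := valP d; rewrite mem_oppset => cC e.
  by exists (b, - c); rewrite /= bB cC e opprK eqxx.
pose p d := xchoose (repr d).
have pP d := xchooseP (repr d).
have p1 (x : X) d : val x + (p d).1 \in sumset X B.
  by have /and3P[pB _ _] := pP d; apply: mem_sumset => //; apply: valP.
have p2 (x : X) d : val x + (p d).2 \in sumset X C.
  by have /and3P[_ pC _] := pP d; apply: mem_sumset => //; apply: valP.
pose f (u : X * D) : sumset X B * sumset X C := ([` p1 u.1 u.2], [` p2 u.1 u.2]).
have f_inj : injective f.
  move=> [x d] [x' d'] e; have := congr1 (val \o fst) e; have := congr1 (val \o snd) e.
  move=> /= e2 e1; have /and3P[_ _ /eqP dE] := pP d; have /and3P[_ _ /eqP dE'] := pP d'.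
  have ed : d = d'.
    apply: val_inj; rewrite dE dE' -!/(p _); move: e1 e2.
    move: (val x) (val x') (p d) (p d') => u u' v v'; lia.
  by move: e1; rewrite ed => /addIr/val_inj ->.
by have := leq_card f f_inj; rewrite !card_prod !cardfE.
Qed.

(** For the minimiser [X], every further summand [A] costs only a factor k, so |X + nA| <= k^n |X|.
    The triangle inequality through [X] passes to nA - mA, and |X| <= |A|. *)
Lemma plunnecke_ruzsa (A : {fset int}) (k n m : nat) : A != fset0 ->
  (#|` sumset A A| <= k * #|` A|)%N ->
  (#|` sumset (nsum n A) (oppset (nsum m A))| <= k ^ (n + m) * #|` A|)%N.
Proof.
move=> A0 hA; have [X [XA X0 hX hC]] := petridis A0.
have cA0 : (0 < #|` A|)%N by rewrite cardfs_gt0.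
have cX0 : (0 < #|` X|)%N by rewrite cardfs_gt0.
have kX : (#|` sumset X A| <= k * #|` X|)%N by nia.
have kC C : (#|` sumset C (sumset X A)| <= k * #|` sumset C X|)%N.
  by have := hC C; move: #|` sumset C _| #|` sumset C _| => a b; nia.
have kn i : (#|` sumset X (nsum i A)| <= k ^ i * #|` X|)%N.
  elim: i => [|i IHi] /=; first by rewrite sumset0 mul1n.
  rewrite sumsetA sumsetC (leq_trans (kC _)) // sumsetC expnS -mulnA.
  by rewrite leq_mul2l IHi orbT.
have XleA : (#|` X| <= #|` A|)%N by apply: fsubset_leq_card.
have := ruzsa_triangle X (nsum n A) (nsum m A); have := kn n; have := kn m.
rewrite expnD; move: #|` sumset X _| #|` sumset X _| #|` sumset _ (oppset _)| => a b c ha hb h.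
have : (a * b <= k ^ n * #|` X| * (k ^ m * #|` X|))%N by rewrite leq_mul.
move: (k ^ n)%N (k ^ m)%N ha hb => u v ha hb h1.
rewrite -(leq_pmul2l cX0); apply: leq_trans h (leq_trans h1 _).
have -> : (u * #|` X| * (v * #|` X|) = #|` X| * (u * v * #|` X|))%N by lia.
by rewrite leq_mul2l leq_mul2l XleA !orbT.
Qed.

(** * Ruzsa's model lemma *)

Lemma sumr_seq_bounds (s : seq int) (f : int -> int) (m l u : int) :
  {in s, forall x, l <= m * f x < u} -> (0 < size s)%N ->
  (size s)%:Z * l <= m * \sum_(x <- s) f x < (size s)%:Z * u.
Proof.
elim: s => // x s IHs h _; rewrite big_cons mulrDr /=.
have hx := h x (mem_head _ _).
case: s IHs h => [|y s] IHs h; first by rewrite big_nil !mul1r mulr0 addr0.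
have e z : z \in y :: s -> z \in x :: y :: s by move=> zs; rewrite inE zs orbT.
have := IHs (fun z zs => h z (e z zs)) isT; rewrite /=.
set S := \sum_(_ <- _) _; move: hx; move: (m * f x) (m * S) => a b.
lia.
Qed.

(** Counting: for nonzero d in [D] and a nonzero multiple v of [N] with |v| < p, at most one q in 1,
    ..., p - 1 has q d = v modulo p. There are at most 2 |D| [J] such pairs, where [J] counts the
    positive multiples of [N] below [p] and the boolean stores the sign. This is less than p - 1, so
    some q avoids them all; v = 0 is excluded by primality. *)
Lemma good_dilation (D : {fset int}) (N p : nat) : prime p -> (2 * #|` D| < N)%N ->
  {in D, forall d, `|d| < p%:Z} ->
  exists q : int, forall d v : int, d \in D -> (N %| v)%Z -> `|v| < p%:Z ->
    (p %| v - q * d)%Z -> d = 0.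
Proof.
move=> p_pr hN hD; have p1 := prime_gt1 p_pr.
have small_diff (a b : nat) : (a < p.-1)%N -> (b < p.-1)%N -> `|a%:Z - b%:Z| < p%:Z by lia.
have dvd0 (z : int) : (p %| z)%Z -> `|z| < p%:Z -> z = 0.
  move=> /dvdzP[w ->] h; have [->|w0] := eqVneq w 0; first by rewrite mul0r.
  by nia.
pose J := (p.-1 %/ N)%N.
pose val3 (u : bool * 'I_J) : int := (-1) ^+ u.1 * (N%:Z * (u.2.+1)%:Z).
pose bad (q : 'I_p.-1) (u : D * (bool * 'I_J)) :=
  (val u.1 != 0) && (p %| val3 u.2 - q.+1%:Z * val u.1)%Z.
have [all_bad|] := boolP [forall q, [exists u, bad q u]].
  have badP (q : 'I_p.-1) : exists u, bad q u by have /existsP := forallP all_bad q.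
  pose g q := xchoose (badP q).
  have g_inj : injective g.
    move=> q q' e; have /andP[d0 h] := xchooseP (badP q); have /andP[_ h'] := xchooseP (badP q').
    rewrite -/(g q) in d0 h; rewrite -/(g q') -e in h'.
    move: (valP (g q).1) d0 h h'; move: (val (g q).1) (val3 _) => d v /hD dp d0 h h'.
    have : (p %| (q%:Z - q'%:Z) * d)%Z.
      rewrite (_ : _ * d = (v - q'.+1%:Z * d) - (v - q.+1%:Z * d)); last by lia.
      exact: rpredB h' h.
    have pz : (p %| (q%:Z - q'%:Z) * d)%Z -> (p %| q%:Z - q'%:Z)%Z || (p %| d)%Z.
      by rewrite !dvdzE abszM /= Euclid_dvdM.
    move=> /pz /orP[/dvd0 hq|/dvd0 /(_ dp) d0'].
      have /eqP := hq (small_diff _ _ (ltn_ord q) (ltn_ord q')).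
      by rewrite subr_eq0 => /eqP [] /val_inj.
    by rewrite d0' eqxx in d0.
  have := leq_card g g_inj; rewrite !card_prod card_bool !card_ord -cardfE => le.
  have := leq_trunc_div p.-1 N; rewrite -/J => le2.
  by exfalso; nia.
move=> /forallPn[q /existsPn hq]; exists q.+1%:Z => d v dD Nv vp pv.
have [//|d0] := eqVneq d 0.
have dp := hD d dD.
have [v0|v0] := eqVneq v 0.
  move: pv; rewrite v0 add0r rpredN dvdzE abszM Euclid_dvdM //= => /orP[/dvdn_leq|].
    by have := ltn_ord q; lia.
  by move=> h; apply: dvd0.
have [w vE] := dvdzP Nv.
have w0 : (0 < absz w)%N.
  by rewrite absz_gt0; apply: contraNneq v0 => w0; rewrite vE w0 mul0r.
have vE' : absz v = (absz w * N)%N by rewrite vE abszM.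
have wJ : ((absz w).-1 < J)%N.
  rewrite prednK // /J leq_divRL ?(leq_trans _ hN) // -vE'.
  by move: vp; rewrite -abszE ltz_nat => h; rewrite -ltnS prednK // ltnW.
have := hq ([` dD], (v < 0, Ordinal wJ)); rewrite /bad /= d0 /=.
have -> : val3 (v < 0, Ordinal wJ) = v.
  by rewrite /val3 /= prednK // [RHS]intEsign vE' PoszM [N%:Z * _]mulrC.
by rewrite pv.
Qed.

Lemma pigeonhole_fset (T : choiceType) (A : {fset T}) (m : nat) (f : T -> nat) : (0 < m)%N ->
  {in A, forall a, f a < m}%N ->
  exists i, (#|` A| <= m * #|` [fset a in A | f a == i]|)%N.
Proof.
move=> m0 hf; have [h|] := boolP [exists i : 'I_m, #|` A| <= m * #|` [fset a in A | f a == i]|]%N.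
  by have [i hi] := existsP h; exists (val i).
move=> /existsPn h.
have cardE (i : nat) : #|` [fset a in A | f a == i]| = (\sum_(a <- A) (f a == i))%N.
  rewrite -big_mkcond sum1_count -size_filter; apply/perm_size/uniq_perm.
  - exact: fset_uniq.
  - exact/filter_uniq/fset_uniq.
  by move=> a; rewrite mem_filter !inE /= andbC.
have sumA : (\sum_(i < m) #|` [fset a in A | f a == i]| = #|` A|)%N.
  under eq_bigr do rewrite cardE.
  rewrite exchange_big /= -sum1_size big_seq [RHS]big_seq; apply: eq_bigr => a aA.
  rewrite (bigD1 (Ordinal (hf a aA))) //= eqxx big1 // => i /negbTE.
  by rewrite -val_eqE /= eq_sym => ->.
have : (m * #|` A| < m * #|` A|)%N.
  rewrite -{1}sumA big_distrr /= -[X in (_ < X * _)%N](card_ord m) -sum_nat_const.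
  have : (\sum_(i < m) (m * #|` [fset a in A | f a == i]|).+1 <= \sum_(i < m) #|` A|)%N.
    by apply: leq_sum => i _; rewrite ltnNge; exact: h.
  apply: leq_trans; under [leqRHS]eq_bigr do rewrite -addn1.
  by rewrite big_split /= [X in (_ < _ + X)%N]sum_nat_const card_ord muln1 -addn1 leq_add2l.
by rewrite ltnn.
Qed.

(** [F] is dilation by q reduced to [0, p), and [A1] keeps the most popular of m intervals of length
    p / m. Two sums of m values of [F] on [A1] then differ by some v with |v| < p, and v = q d
    modulo p for the difference d of the sums in Z. If d = 0 this forces v = 0; if N divides v the
    choice of q forces d = 0. *)
Lemma ruzsa_model (A : {fset int}) (m N : nat) : (0 < m)%N ->
  (2 * #|` sumset (nsum m A) (oppset (nsum m A))| < N)%N ->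
  exists (A1 : {fset int}) (F : int -> int), [/\ A1 `<=` A, (#|` A| <= m * #|` A1|)%N &
    forall s t : seq int, {subset s <= A1} -> {subset t <= A1} -> size s = m -> size t = m ->
      (\sum_(x <- s) x = \sum_(x <- t) x <->
       (N %| \sum_(x <- s) F x - \sum_(x <- t) F x)%Z)].
Proof.
move=> m0 hN; set D := sumset _ _ in hN.
pose M := (\sum_(d <- D) absz d)%N.
have [p pM p_pr] := prime_above M.
have hD d : d \in D -> `|d| < p%:Z.
  move=> dD; have : (absz d <= M)%N by rewrite /M (big_fsetD1 d) //= leq_addr.
  lia.
have [q hq] := good_dilation p_pr hN hD.
have p0 : (0 < p)%N by apply: prime_gt0.
pose F (a : int) : int := ((q * a) %% p%:Z)%Z.
pose idx a := absz ((m%:Z * F a) %/ p%:Z)%Z.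
have FP a : 0 <= F a < p%:Z by rewrite /F modz_ge0 ?ltz_pmod //; lia.
have idxP a : (idx a)%:Z * p%:Z <= m%:Z * F a < (idx a)%:Z * p%:Z + p%:Z.
  have pz : 0 < p%:Z by lia.
  have /andP[F0 _] := FP a; rewrite /idx gez0_abs ?divz_ge0 ?mulr_ge0 //.
  by rewrite lez_floor ?gt_eqF //=; have := ltz_ceil (m%:Z * F a) pz; rewrite mulrDl mul1r.
have idx_lt a : a \in A -> (idx a < m)%N.
  move=> _; have := FP a; have := idxP a; nia.
have [i hi] := pigeonhole_fset m0 idx_lt.
exists [fset a in A | idx a == i], F; split=> //.
  by apply/fsubsetP => x; rewrite !inE => /andP[].
set A1 := [fset _ in _ | _] => s t sA tA sm tm.
have bnd u : {subset u <= A1} -> size u = m ->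
    m%:Z * (i%:Z * p%:Z) <= m%:Z * \sum_(x <- u) F x < m%:Z * (i%:Z * p%:Z + p%:Z).
  move=> uA um; rewrite -{1 4}um; apply: sumr_seq_bounds; last by rewrite um.
  by move=> x /uA; rewrite !inE => /andP[_ /eqP <-].
have lt_p : `|\sum_(x <- s) F x - \sum_(x <- t) F x| < p%:Z.
  have := bnd s sA sm; have := bnd t tA tm.
  move: (\sum_(x <- s) F x) (\sum_(x <- t) F x) => S T; nia.
have modp : (p %| \sum_(x <- s) F x - \sum_(x <- t) F x -
    q * (\sum_(x <- s) x - \sum_(x <- t) x))%Z.
  have h u : (p %| \sum_(x <- u) F x - q * \sum_(x <- u) x)%Z.
    rewrite mulr_sumr -sumrB; apply: rpred_sum => x _.
    rewrite -rpredN opprB -/(_ \in _) /F; apply/dvdzP; exists ((q * x) %/ p)%Z.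
    by rewrite {1}(divz_eq (q * x) p) addrK.
  rewrite (_ : _ - _ * _ = (\sum_(x <- s) F x - q * \sum_(x <- s) x) -
    (\sum_(x <- t) F x - q * \sum_(x <- t) x)); last by ring.
  exact: rpredB (h s) (h t).
have sub u : {subset u <= A1} -> {subset u <= A}.
  by move=> uA x /uA; rewrite !inE => /andP[].
have dD : \sum_(x <- s) x - \sum_(x <- t) x \in D.
  apply: mem_sumset; first by rewrite -sm; apply/mem_nsum/sub.
  by rewrite mem_oppset opprK -tm; apply/mem_nsum/sub.
split=> [e|h]; last by apply/eqP; rewrite -subr_eq0 (hq _ _ dD h lt_p modp).
move: modp; rewrite e subrr mulr0 subr0 => /dvdzP[w] ew.
move: lt_p; rewrite ew normrM [X in _ * X < _]ger0_norm // -[ltRHS]mul1r ltr_pM2r // => lt1.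
by rewrite (_ : w = 0) ?mul0r //; lia.
Qed.

(** * Bogolyubov's lemma *)

(** Real part of the additive character of Z/N at y. It suffices because the Fourier sums below run
    over symmetric sets of differences. *)
Definition cosz (R : realType) (N : nat) (y : int) : R :=
  cos (pi *+ 2 * (y%:~R / N%:R)).

Lemma cosz_periodic (R : realType) N (y w : int) : (0 < N)%N ->
  cosz R N (y + N%:Z * w) = cosz R N y.
Proof.
move=> N0; rewrite /cosz; move: (pi *+ 2) (@cosD2pi R) => p per.
have nat_case (n : nat) (z : int) : cos (p * ((z + N%:Z * n%:Z)%:~R / N%:R)) =
    cos (p * (z%:~R / N%:R)) :> R.
  rewrite intrD intrM -!pmulrn mulrDl mulrDr [N%:R * _]mulrC mulfK ?pnatr_eq0 -?lt0n //.
  by rewrite mulr_natr; apply: periodicn.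
case: w => n; first exact: nat_case.
rewrite -[in RHS](subrK (N%:Z * n.+1%:Z) y) nat_case NegzE mulrN //.
Qed.

Lemma cosz0 (R : realType) N : cosz R N 0 = 1.
Proof. by rewrite /cosz mul0r mulr0 cos0. Qed.

Lemma cosz_sum_eq0 (R : realType) N (y : int) : (0 < N)%N -> ~~ (N %| y)%Z ->
  \sum_(r < N) cosz R N (r%:Z * y) = 0.
Proof.
move=> N0 Ny; have Nr : N%:R != 0 :> R by rewrite pnatr_eq0 -lt0n.
have : (0 < y %% N)%Z.
  by rewrite lt_neqAle modz_ge0 ?andbT 1?eq_sym; [apply: contra Ny => /eqP/dvdz_mod0P|lia].
have : (y %% N < N)%Z by rewrite ltz_pmod.
have : \sum_(r < N) cosz R N (r%:Z * y) = \sum_(r < N) cosz R N (r%:Z * (y %% N)%Z).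
  apply: eq_bigr => r _; rewrite -[in RHS](cosz_periodic _ _ (r%:Z * (y %/ N)%Z) N0).
  by congr cosz; rewrite [in LHS](divz_eq y N); ring.
move=> ->; move: (modz _ _) => {Ny} z zN z0.
pose h : R := pi * (z%:~R / N%:R).
(* The sum telescopes after multiplication by 2 sin h, as 2 sin h cos(2 r h) = sin((2 r + 1) h) -
   sin((2 r - 1) h). At n = N the two remaining sines cancel, and sin h > 0 since 0 < z < N. *)
have sum_eq n : sin h * \sum_(r < n) cosz R N (r%:Z * z) *+ 2 =
    sin ((n%:R * 2 - 1) * h) + sin h.
  elim: n => [|n IHn].
    by rewrite big_ord0 mulr0 mul0r add0r mulN1r sinN addNr.
  rewrite big_ord_recr /= mulrDr {}IHn.
  have -> : cosz R N (n%:Z * z) = cos (n%:R * 2 * h).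
    by rewrite /cosz intrM -pmulrn; congr cos; rewrite /h; ring.
  have -> : (n.+1%:R * 2 - 1) * h = n%:R * 2 * h + h by rewrite -natr1; ring.
  have -> : (n%:R * 2 - 1) * h = n%:R * 2 * h - h by ring.
  by rewrite sinB sinD; ring.
have hP : 0 < h < pi.
  rewrite /h mulr_gt0 ?pi_gt0 ?divr_gt0 ?ltr0z ?ltr0n //=.
  by rewrite gtr_pMr ?pi_gt0 // ltr_pdivrMr ?ltr0n // mul1r pmulrn ltr_int.
have := sum_eq N.
have -> : (N%:R * 2 - 1) * h = - h + pi *+ 2 *+ absz z.
  have zE : (absz z)%:R = z%:~R :> R by rewrite pmulrn gtz0_abs.
  by rewrite -[_ *+ 2 *+ _]mulr_natr zE /h; field.
rewrite (periodicn (@sinD2pi R)) sinN addNr sumrMnl => /eqP.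
by rewrite mulf_eq0 gt_eqF ?sin_gt0_pi //= mulrn_eq0 => /eqP.
Qed.

Lemma cosz_ge0 (R : realType) N (y w : int) : (0 < N)%N ->
  `|4 * (y + N%:Z * w)| <= N%:Z -> 0 <= cosz R N y.
Proof.
move=> N0; rewrite -(cosz_periodic R y w N0); move: (y + _) => z hz.
apply: cos_ge0_pihalf.
have e : pi *+ 2 * (z%:~R / N%:R) = pi / 2 * ((4 * z)%:~R / N%:R) :> R.
  rewrite intrM; field; by rewrite pnatr_eq0 -lt0n.
have p0 : 0 < pi / 2 :> R by rewrite divr_gt0 ?pi_gt0.
have : `|(4 * z)%:~R / N%:R| <= 1 :> R.
  rewrite normrM normfV normr_nat ler_pdivrMr ?ltr0n // mul1r -intr_norm.
  by rewrite [N%:R]pmulrn ler_int.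
rewrite ler_norml e; move: (_ / _) => t /andP[h1 h2].
by rewrite -mulrN1 !ler_pM2l ?h1 //= ler_piMr // ltW.
Qed.

Lemma cosz_prod3 (R : realType) N (u v x : int) :
  cosz R N u * cosz R N v * cosz R N x * 4 =
  cosz R N (u + v + x) + cosz R N (u + v - x) + cosz R N (u - v + x) + cosz R N (u - v - x).
Proof.
rewrite /cosz !intrD !intrN.
have e (a b : R) : pi *+ 2 * ((a + b) / N%:R) = pi *+ 2 * (a / N%:R) + pi *+ 2 * (b / N%:R) by ring.
have n (a : R) : pi *+ 2 * ((- a) / N%:R) = - (pi *+ 2 * (a / N%:R)) by ring.
rewrite !e !n; move: (pi *+ 2 * _) (pi *+ 2 * _) (pi *+ 2 * _) => a b c.
rewrite !(cosD, sinD, cosN, sinN); ring.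
Qed.

(* If [x] is not in [2B - 2B], the fourth-moment sum of [|\hat B r|^4 cos(2 pi r x / N)]
   vanishes, while the large frequencies [G] contribute more than the others can cancel. *)
Lemma bogolyubov (R : realType) (N : nat) (B : seq int) :
  (0 < N)%N -> uniq B -> (0 < size B)%N ->
  {in B &, forall a b, (N %| a - b)%Z -> a = b} ->
  exists G : seq int, [/\ (size G * size B ^ 2 <= N ^ 2)%N,
    {in G, forall r, 0 <= r < N%:Z} &
    forall x : int, (forall r, r \in G -> exists w, `|4 * (r * x + N%:Z * w)| <= N%:Z) ->
    exists a b c d, [/\ a \in B, b \in B, c \in B, d \in B &
      (N %| a + c - (b + d) - x)%Z]].
Proof.
move=> N0 uB B0 injB.
pose D := [seq a - b | a <- B, b <- B].
(* [D] lists differences with multiplicity, so [g r] is the squared modulus of the Fourier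
   coefficient of [B] at r. *)
pose g (r : 'I_N) : R := \sum_(u <- D) cosz R N (r%:Z * u).
have g_ge0 r : 0 <= g r.
  pose C : R := \sum_(a <- B) cosz R N (r%:Z * a).
  pose S : R := \sum_(a <- B) sin (pi *+ 2 * ((r%:Z * a)%:~R / N%:R)).
  have -> : g r = C ^+ 2 + S ^+ 2.
    rewrite /g /D big_allpairs_dep !expr2 /C /S !mulr_suml -big_split /=.
    apply: eq_bigr => a _; rewrite !mulr_sumr -big_split /=; apply: eq_bigr => b _.
    by rewrite /cosz mulrBr intrB mulrBl mulrBr cosB.
  by rewrite addr_ge0 ?sqr_ge0.
have D_opp u : u \in D -> - u \in D.
  by move=> /allpairsP[[a b] [/= aB bB ->]]; rewrite opprB; apply/allpairsP; exists (b, a).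
pose beta : R := (size B)%:R.
have beta0 : 0 < beta by rewrite ltr0n.
have Nr0 : 0 < N%:R :> R by rewrite ltr0n.
have sum_g : \sum_r g r = N%:R * beta.
  rewrite exchange_big /D big_allpairs_dep /=.
  have -> : N%:R * beta = \sum_(a <- B) N%:R.
    by rewrite /beta big_const_seq count_predT iter_addr_0 mulr_natr.
  apply: eq_big_seq => a aB; rewrite (bigD1_seq a) //= subrr.
  under eq_bigr do rewrite mulr0 cosz0.
  rewrite sumr_const card_ord big_seq_cond big1 ?addr0 // => b /andP[bB ba].
  by apply: cosz_sum_eq0 => //; apply: contra ba => /injB -> .
have g0 : g (Ordinal N0) = beta ^+ 2.
  rewrite /g /D big_allpairs_dep /=.
  under eq_bigr do under eq_bigr do rewrite mul0r cosz0.
  by rewrite !big_const_seq !count_predT !iter_addr_0 -mulrnA natrM.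
(* The total mass of [g] is N beta, so at most N^2 / beta^2 frequencies reach this threshold.
   Frequency 0 is among them and contributes beta^4 = tau N beta, whereas the small ones contribute
   at least - tau (N beta - beta^2); the surplus tau beta^2 is positive. *)
pose tau : R := beta ^+ 3 / N%:R.
have tau0 : 0 < tau by rewrite divr_gt0 ?exprn_gt0.
pose big := [pred r | tau <= g r].
exists [seq (val r)%:Z | r <- enum big]; split.
- rewrite size_map -cardE -(ler_nat R) natrM !natrX -/beta.
  have : tau * #|big|%:R <= N%:R * beta.
    rewrite -sum_g (bigID big) /= ler_wpDr ?sumr_ge0 // mulr_natr -sumr_const.
    exact: ler_sum.
  rewrite /tau mulrAC ler_pdivrMr // => h.
  rewrite -(ler_pM2r beta0); move: (#|_|%:R : R) h => m h.
  by rewrite (_ : m * _ * _ = beta ^+ 3 * m) 1?(_ : _ ^+ 2 * _ = N%:R * beta * N%:R); [|ring..].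
- by move=> _ /mapP[r _ ->]; rewrite le0z_nat ltz_nat ltn_ord.
move=> x hx; apply: contrapT => noRep.
have noD u v : u \in D -> v \in D -> ~~ (N %| u + v - x)%Z.
  move=> /allpairsP[[a b] [/= aB bB ->]] /allpairsP[[c d] [/= cB dB ->]].
  apply/negP => h; apply: noRep; exists a, b, c, d; split=> //.
  by move: h; congr (is_true (_ %| _)%Z); ring.
(* Each triple product of cosines is an average of four characters, at u + v - x and its variants by
   signs of u and v, up to a global sign. As [D] is symmetric, [noD] applies to all four and
   orthogonality makes them vanish. *)
have T0 : \sum_r g r ^+ 2 * cosz R N (r%:Z * x) = 0.
  have -> : \sum_r g r ^+ 2 * cosz R N (r%:Z * x) =
      \sum_(u <- D) \sum_(v <- D) \sum_(r < N)
        cosz R N (r%:Z * u) * cosz R N (r%:Z * v) * cosz R N (r%:Z * x).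
    under [RHS]eq_bigr do rewrite exchange_big.
    rewrite [RHS]exchange_big; apply: eq_bigr => r _ /=.
    rewrite expr2 {1}/g !mulr_suml; apply: eq_bigr => u _.
    by rewrite /g mulr_sumr mulr_suml.
  rewrite big_seq big1 // => u uD; rewrite big_seq big1 // => v vD.
  have f0 : 4 != 0 :> R by rewrite pnatr_eq0.
  apply: (mulIf f0); rewrite mul0r mulr_suml.
  under eq_bigr do rewrite cosz_prod3 -!mulrN -!mulrDr.
  rewrite !big_split /= !cosz_sum_eq0 ?addr0 //.
  - have := noD _ _ uD (D_opp _ vD); exact.
  - have := noD _ _ (D_opp _ uD) vD.
    by rewrite (_ : - u + v - x = - (u - v + x)) ?rpredN //; ring.
  - exact: noD.
  have := noD _ _ (D_opp _ uD) (D_opp _ vD).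
  by rewrite (_ : - u - v - x = - (u + v + x)) ?rpredN //; ring.
have beta_le : beta <= N%:R.
  rewrite -(ler_pM2r beta0) -sum_g -expr2 -g0 (bigD1 (Ordinal N0)) //= ler_wpDr //.
  exact: sumr_ge0.
have big0 : big (Ordinal N0).
  by rewrite /= g0 /tau ler_pdivrMr // exprS mulrC ler_pM2l ?exprn_gt0.
have sum_big : beta ^+ 4 <= \sum_(r | big r) g r ^+ 2 * cosz R N (r%:Z * x).
  rewrite (bigD1 (Ordinal N0)) //= g0 mul0r cosz0 mulr1 -exprM ler_wpDr //.
  apply: sumr_ge0 => r /andP[br _]; rewrite mulr_ge0 ?sqr_ge0 //.
  have [|w hw] := hx r%:Z; last exact: cosz_ge0 hw.
  by apply/mapP; exists r; rewrite // mem_enum.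
have sum_small : - (tau * (N%:R * beta - beta ^+ 2)) <=
    \sum_(r | ~~ big r) g r ^+ 2 * cosz R N (r%:Z * x).
  apply: le_trans (_ : \sum_(r | ~~ big r) - (tau * g r) <= _).
    rewrite sumrN -mulr_sumr lerN2 ler_pM2l // lerBrDr -sum_g [leRHS](bigID big) /=.
    by rewrite [leLHS]addrC lerD2r -g0 (bigD1 (Ordinal N0)) //= ler_wpDr ?sumr_ge0.
  apply: ler_sum => r; rewrite -ltNge => /ltW hr.
  have c1 : -1 <= cosz R N (r%:Z * x) by apply: cos_geN1.
  apply: le_trans (_ : - g r ^+ 2 <= _).
    by rewrite lerN2 expr2 ler_wpM2r.
  by rewrite -mulrN1 ler_wpM2l // sqr_ge0.
move: T0; apply/eqP; rewrite gt_eqF // (bigID big) /=.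
apply: lt_le_trans (lerD sum_big sum_small).
have -> : beta ^+ 4 - tau * (N%:R * beta - beta ^+ 2) = tau * beta ^+ 2.
  rewrite /tau; field; exact: lt0r_neq0.
by rewrite mulr_gt0 ?exprn_gt0.
Qed.

(** * Linear forms on lattice points of a box *)

(** As in the simplex method, a feasible point is moved in a direction [w] that keeps the tight
    constraints [T] tight, until a new one becomes tight. Some constraint varies along [w] because
    [S] spans, and up to the sign of [w] it decreases. The new row is independent of [T], since it
    is nonzero on [w] and [T] is not. *)
Lemma polyhedron_partial_vertex (F : realFieldType) (d : nat) (S : seq 'rV[F]_d)
    (v0 : 'cV[F]_d) :
  (forall s, s \in S -> 1 <= (s *m v0) 0 0) ->
  (forall w : 'cV[F]_d, (forall s, s \in S -> s *m w = 0) -> w = 0) ->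
  forall j, (j <= d)%N ->
  exists (T : 'M[F]_(j, d)) (v : 'cV[F]_d),
    [/\ forall i, row i T \in S, row_free T, T *m v = const_mx 1
      & forall s, s \in S -> 1 <= (s *m v) 0 0].
Proof.
move=> hv0 spanS; elim=> [|j IHj] lejd.
  exists 0, v0; split=> //; first by case.
    by rewrite /row_free mxrank0.
  by apply/matrixP=> -[].
have [T [v [TS freeT Tv hv]]] := IHj (ltnW lejd).
have [w w0 Tw] : exists2 w : 'cV[F]_d, w != 0 & T *m w = 0.
  have : cokermx T != 0.
    by rewrite -mxrank_eq0 mxrank_coker (eqP freeT) subn_eq0 -ltnNge.
  move=> /matrix0Pn[i [k nz]].
  exists (col k (cokermx T)); last by rewrite colE mulmxA mulmx_coker mul0mx.
  by apply/matrix0Pn; exists i, 0; rewrite mxE.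
have [s0 s0S s0w] : exists2 s, s \in S & (s *m w) 0 0 != 0.
  have [/hasP[s sS hs]|/hasPn hn] := boolP (has (fun s => (s *m w) 0 0 != 0) S); first by exists s.
  case/eqP: w0; apply: spanS => s /hn; rewrite negbK => /eqP e.
  by apply/matrixP=> a b; rewrite !ord1 e mxE.
wlog s0lt : w w0 Tw s0w / (s0 *m w) 0 0 < 0.
  move=> H; have [lt|gt|eq] := ltgtP ((s0 *m w) 0 0) 0; first exact: (H w).
    apply: (H (- w)).
    - by rewrite oppr_eq0.
    - by rewrite mulmxN Tw oppr0.
    - by rewrite mulmxN mxE oppr_eq0.
    - by rewrite mulmxN mxE oppr_lt0.
  by rewrite eq eqxx in s0w.
(* The time at which the decreasing constraint [s] reaches 1 when moving from [v] along [w]; the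
   smallest such time keeps all the others satisfied. *)
pose r (s : 'rV[F]_d) := ((s *m v) 0 0 - 1) / - (s *m w) 0 0.
have [s [sS sw smin]] : exists s, [/\ s \in S, (s *m w) 0 0 < 0 &
    forall t, t \in S -> (t *m w) 0 0 < 0 -> r s <= r t].
  have hin : s0 \in S by [].
  pose i0 : seq_sub S := SeqSub s0S.
  have i0P : (ssval i0 *m w) 0 0 < 0 by [].
  have := @Order.TotalTheory.arg_minP _ F (seq_sub S) i0 (fun i => (ssval i *m w) 0 0 < 0)
    (fun i => r (ssval i)) i0P.
  case=> i iP imin.
  exists (ssval i); split=> //; first exact: ssvalP.
  by move=> t tS tw; apply: (imin (SeqSub tS)).
have rs0 : 0 <= r s.
  by rewrite divr_ge0 ?subr_ge0 ?hv // oppr_ge0 ltW.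
rewrite -addn1; exists (col_mx T s), (v + r s *: w); split.
- move=> i; rewrite -[i]splitK; case: (split i) => k /=.
    by rewrite rowKu.
  by rewrite rowKd row_id.
- apply: inj_row_free => u; rewrite -[u]hsubmxK mul_row_col => hu.
  have u2 : rsubmx u = 0.
    have : (lsubmx u *m T + rsubmx u *m s) *m w = 0 by rewrite hu mul0mx.
    rewrite mulmxDl -!mulmxA Tw mulmx0 add0r => /matrixP/(_ 0 0).
    rewrite mxE big_ord1 [RHS]mxE => /eqP; rewrite mulf_eq0 (lt_eqF sw) orbF => /eqP e.
    by apply/matrixP=> a b; rewrite !ord1 e mxE.
  have u1 : lsubmx u = 0.
    move: hu; rewrite u2 mul0mx addr0 -(mul0mx _ T) => /row_free_inj.
    exact.
  by rewrite u1 u2 row_mx0.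
- rewrite mul_col_mx !mulmxDr -!scalemxAr Tw scaler0 addr0 Tv.
  rewrite -[RHS]vsubmxK; congr col_mx; apply/matrixP=> a b; rewrite !ord1 ?mxE //.
  have -> : \sum_j s 0 j * v j 0 = (s *m v) 0 0 by rewrite mxE.
  have -> : \sum_j s 0 j * w j 0 = (s *m w) 0 0 by rewrite mxE.
  by rewrite /r; field; rewrite lt_eqF.
- move=> t tS; rewrite mulmxDr -scalemxAr mxE [X in _ + X]mxE.
  have [tw|tw] := leP 0 ((t *m w) 0 0).
    by apply: ler_wpDr (hv _ tS); rewrite mulr_ge0.
  have := smin t tS tw; rewrite {2}/r ler_pdivlMr ?oppr_gt0 //.
  lra.
Qed.

(** The rows of [U] are a basis of the lattice and [c] holds coordinates, so lattice points are
    plain integer vectors and the box is a sup-norm ball of the ambient space. *)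
Definition in_box (d : nat) (U : 'M[int]_d) (rho : int) (c : 'rV[int]_d) : bool :=
  [forall j, `|(c *m U) 0 j| <= rho].

Lemma in_boxP (d : nat) (U : 'M[int]_d) (rho : int) (c : 'rV[int]_d) :
  reflect (forall j, `|(c *m U) 0 j| <= rho) (in_box U rho c).
Proof. exact: forallP. Qed.

Lemma in_box_le d (U : 'M[int]_d) (rho rho' : int) c :
  rho <= rho' -> in_box U rho c -> in_box U rho' c.
Proof. by move=> le /in_boxP h; apply/in_boxP => j; apply: le_trans le. Qed.

Lemma in_boxD d (U : 'M[int]_d) (rho rho' : int) c c' :
  in_box U rho c -> in_box U rho' c' -> in_box U (rho + rho') (c + c').
Proof.
move=> /in_boxP h /in_boxP h'; apply/in_boxP => j; rewrite mulmxDl mxE.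
by apply: le_trans (ler_normD _ _) _; apply: lerD.
Qed.

Lemma in_boxN d (U : 'M[int]_d) (rho : int) c : in_box U rho (- c) = in_box U rho c.
Proof. by apply: eq_forallb => j; rewrite mulNmx mxE normrN. Qed.

Lemma in_box0 d (U : 'M[int]_d) (rho : int) : 0 <= rho -> in_box U rho 0.
Proof. by move=> h; apply/in_boxP => j; rewrite mul0mx mxE normr0. Qed.

(** Cramer's rule in adjugate form: [s *m \adj X] is the determinant of [X] times the coordinates of
    [s] in the rows of [X]. *)
Lemma det_replace_row (R : comNzRingType) d (X : 'M[R]_d) (s : 'rV[R]_d) i :
  \det (\matrix_k (if k == i then s else row k X)) = (s *m \adj X) 0 i.
Proof.
rewrite (expand_det_row _ i) mxE; apply: eq_bigr => j _.
rewrite !mxE eqxx; congr (_ * _); rewrite /cofactor; congr (_ * \det _).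
by apply/matrixP => a b; rewrite !mxE eq_sym (negbTE (neq_lift _ _)) mxE.
Qed.

Lemma normr_det_le (R : realDomainType) d (M : 'M[R]_d) (B : R) :
  (forall i j, `|M i j| <= B) -> `|\det M| <= d`!%:R * B ^+ d.
Proof.
move=> hM; rewrite /determinant; apply: le_trans (ler_norm_sum _ _ _) _.
have -> : d`!%:R * B ^+ d = \sum_(s : 'S_d) B ^+ d.
  by rewrite sumr_const card_Sn mulr_natl.
apply: ler_sum => s _; rewrite normrM normrX normrN1 expr1n mul1r normr_prod.
rewrite -[X in B ^+ X]card_ord -prodr_const.
by apply: ler_prod => i _; rewrite normr_ge0 hM.
Qed.

Lemma in_box_enum d (U : 'M[int]_d) (rho : int) : \det U != 0 ->
  exists S : seq 'rV[int]_d, forall c, (c \in S) = in_box U rho c.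
Proof.
move=> U0.
pose M := \sum_(i < d) \sum_(j < d) `|rho| * `|\adj U i j|.
have Mge c : in_box U rho c -> forall j, `|c 0 j| <= M.
  move=> /in_boxP h j.
  have : `|(c *m U *m \adj U) 0 j| <= M.
    rewrite mxE; apply: le_trans (ler_norm_sum _ _ _) _; apply: ler_sum => i _.
    rewrite (bigD1 j) //= ler_wpDr ?sumr_ge0 // normrM ler_wpM2r //.
    by apply: le_trans (h i) (ler_norm _).
  rewrite -mulmxA mul_mx_adj mul_mx_scalar mxE normrM; apply: le_trans.
  by rewrite ler_peMl // -gtz0_ge1 normr_gt0.
have M0 : 0 <= M by apply: sumr_ge0 => i _; apply: sumr_ge0 => j _; rewrite mulr_ge0.
clearbody M.
pose f (g : {ffun 'I_d -> 'I_(`|M|.*2.+1)}) : 'rV[int]_d := \row_j ((g j)%:Z - M).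
exists [seq c <- map f (enum {: {ffun 'I_d -> 'I_(`|M|.*2.+1)}}) | in_box U rho c] => c.
rewrite mem_filter; case: (boolP (in_box U rho c)) => //= hc.
apply/mapP; exists [ffun j => inord (absz (c 0 j + M))]; first by rewrite mem_enum.
apply/rowP => j; have := Mge c hc j; rewrite mxE ffunE; move: (c 0 j) => u hu; rewrite inordK; lia.
Qed.

Lemma local_additive_sum d (U : 'M[int]_d) (P : 'rV[int]_d -> int) (R rho : int)
    (I : eqType) (l : seq I) (x : I -> 'rV[int]_d) (e : I -> int) (c : 'rV[int]_d) (r : int) :
  (forall c c', in_box U R c -> in_box U R c' -> in_box U R (c + c') ->
     P (c + c') = P c + P c') ->
  0 <= rho -> 0 <= r ->
  (forall i, [\/ e i = 0, e i = 1 /\ in_box U rho (x i) | e i = -1 /\ in_box U rho (x i)]) ->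
  in_box U r c -> r + (size l)%:Z * rho <= R ->
  P (c + \sum_(i <- l) x i *~ e i) = P c + \sum_(i <- l) e i * P (x i)
  /\ in_box U (r + (size l)%:Z * rho) (c + \sum_(i <- l) x i *~ e i).
Proof.
move=> addP rho0 r0 he hc; elim: l => [|i l IHl] /= hR.
  by rewrite !big_nil !addr0 mul0r addr0.
have P0 : P 0 = 0.
  have b0 : in_box U R 0 by apply: in_box0; nia.
  by have := addP 0 0; rewrite addr0 => /(_ b0 b0 b0); lia.
have [|IH1 IH2] := IHl; first nia.
have eD : r + (size l).+1%:Z * rho = rho + (r + (size l)%:Z * rho) by lia.
have [eb bx] : P (x i *~ e i) = e i * P (x i) /\ in_box U rho (x i *~ e i).
  have h t : in_box U rho t -> P (- t) = - P t.
    move=> bt; have := addP t (- t); rewrite subrr P0 in_boxN.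
    move=> /(_ (in_box_le _ bt) (in_box_le _ bt) (in_box0 _ _)).
    by nia.
  case: (he i) => [->|[-> bi]|[-> bi]].
  - by rewrite mulr0z P0 mul0r; split=> //; apply: in_box0.
  - by rewrite mulr1z mul1r.
  - by rewrite mulrN1z mulN1r in_boxN h.
rewrite !big_cons addrCA; split; last by rewrite eD; apply: in_boxD.
rewrite addP ?IH1 ?eb; first by rewrite addrCA.
- by apply: in_box_le bx; nia.
- by apply: in_box_le IH2; nia.
- by apply: in_box_le (in_boxD bx IH2); nia.
Qed.

(* Walk through the multiples [t s], reduced modulo the lattice spanned by the
   rows of [X] into a fixed fundamental parallelepiped: every step is a relation
   between points of the box, and the walk is back at [0] at time [D]. *)
Lemma local_additive_linear d (U : 'M[int]_d) (P : 'rV[int]_d -> int) (R rho : int)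
    (X : 'M[int]_d) (D : int) (s k : 'rV[int]_d) :
  (forall c c', in_box U R c -> in_box U R c' -> in_box U R (c + c') ->
     P (c + c') = P c + P c') ->
  0 <= rho -> (d%:Z * 2 + 1) * rho <= R -> 0 < D ->
  in_box U rho s -> D *: s = k *m X ->
  (forall i, `|k 0 i| <= D /\ (in_box U rho (row i X) \/ k 0 i = 0)) ->
  D * P s = \sum_i k 0 i * P (row i X).
Proof.
move=> addP rho0 hR D0 sB sX hk.
(* Since D s = k X, the vector D [q t] is the combination of the rows with coefficients t k_i mod D,
   which lie in [0, D). Hence [q t] stays in the box of radius d rho for all t. *)
pose fl (t : nat) i : int := divz (t%:Z * k 0 i) D.
pose q (t : nat) : 'rV[int]_d := s *+ t - \sum_i row i X *~ fl t i.
have P0 : P 0 = 0.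
  have b0 : in_box U R 0 by apply: in_box0; nia.
  by have := addP 0 0; rewrite addr0 => /(_ b0 b0 b0); lia.
have kX : k *m X = \sum_i row i X *~ k 0 i.
  rewrite mulmx_sum_row; apply: eq_bigr => i _.
  by rewrite -scaler_int intz.
have qB t : in_box U (d%:Z * rho) (q t).
  have Dq : D *: q t = \sum_i row i X *~ (modz (t%:Z * k 0 i) D).
    rewrite /q scalerBr scaler_sumr -scalerMnr sX kX -sumrMnl -sumrB.
    apply: eq_bigr => i _; rewrite /fl -scaler_int.
    rewrite -!scaler_int !intz -scaler_nat !scalerA -scalerBl; congr (_ *: _).
    by rewrite /modz; lia.
  apply/in_boxP => j; rewrite -(ler_pM2l D0).
  have -> : D * `|(q t *m U) 0 j| = `|((D *: q t) *m U) 0 j|.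
    by rewrite -scalemxAl [in RHS]mxE normrM gtr0_norm.
  rewrite Dq mulmx_suml summxE; apply: le_trans (ler_norm_sum _ _ _) _.
  have -> : D * (d%:Z * rho) = \sum_(i < d) D * rho.
    by rewrite sumr_const card_ord -[LHS]/(_ * (_ * _)) mulrCA -mulr_natl natz.
  apply: ler_sum => i _; rewrite -scaler_int intz -scalemxAl mxE normrM.
  have [_ [/in_boxP h|->]] := hk i; last by rewrite mulr0 mod0z normr0 mul0r mulr_ge0 // ltW.
  apply: ler_pM => //.
  by rewrite ger0_norm ?modz_ge0 ?gt_eqF // ltW // ltz_pmod.
have Pq t : P (q t) = t%:Z * P s - \sum_i fl t i * P (row i X).
  elim: t => [|t IHt].
    rewrite /q mulr0n mul0r /fl !big1 ?subrr ?P0 // => i _; rewrite mul0r div0z ?mulr0z ?mul0r //.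
  pose e i := fl t i - fl t.+1 i.
  have qS : q t.+1 = (q t + s) + \sum_i row i X *~ e i.
    rewrite /q mulrSr.
    under [\sum_i _ *~ e i]eq_bigr do rewrite /e mulrzBr.
    rewrite sumrB; set a := \sum_i _ *~ fl t i; set b := \sum_i _ *~ fl t.+1 i.
    by rewrite [RHS]addrACA subrK addrA.
  (* As |k_i| <= D, each floor moves by at most 1 per step. Passing from [q t] to [q t.+1] adds [s]
     and at most d signed rows, within radius d rho + rho + d rho; this is the origin of 2 d + 1. *)
  have eP i : [\/ e i = 0, e i = 1 /\ in_box U rho (row i X) | e i = -1 /\ in_box U rho (row i X)].
    have [kD [bi|k0]] := hk i; last first.
      by constructor 1; rewrite /e /fl k0 !mulr0 subrr.
    have : `|e i| <= 1.
      rewrite /e /fl.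
      have := divz_eq (t%:Z * k 0 i) D; have := divz_eq (t.+1%:Z * k 0 i) D.
      have := ltz_pmod (t%:Z * k 0 i) D0; have := ltz_pmod (t.+1%:Z * k 0 i) D0.
      have D1 : D != 0 by lia.
      have := modz_ge0 (t%:Z * k 0 i) D1; have := modz_ge0 (t.+1%:Z * k 0 i) D1.
      set a := (_ %/ _)%Z; set b := (_ %/ _)%Z; set a' := (_ %% _)%Z; set b' := (_ %% _)%Z.
      have -> : t.+1%:Z * k 0 i = t%:Z * k 0 i + k 0 i by lia.
      move: (t%:Z * k 0 i) (k 0 i) kD => u v *.
      nia.
    case: (e i) => [[|[|n]]|[|n]] // _; [by constructor 1|by constructor 2|by constructor 3].
  have bq : in_box U (d%:Z * rho + rho) (q t + s) by apply: in_boxD.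
  rewrite qS.
  have [||-> _] := @local_additive_sum d U P R rho _ (index_enum 'I_d) (fun i => row i X) e
     (q t + s) (d%:Z * rho + rho) addP rho0 _ eP bq.
  - by nia.
  - by rewrite [index_enum _]unlock -enumT size_enum_ord; nia.
  rewrite addP ?IHt; first last.
  - by apply: in_box_le bq; nia.
  - by apply: in_box_le sB; nia.
  - by apply: in_box_le (qB t); nia.
  have -> : \sum_i e i * P (row i X) = \sum_i fl t i * P (row i X) - \sum_i fl t.+1 i * P (row i X).
    by rewrite -sumrB; apply: eq_bigr => i _; rewrite mulrBl.
  lia.
have flD i : fl `|D|%N i = k 0 i.
  by rewrite /fl gtz0_abs // mulrC mulzK // gt_eqF.
have q0 : q `|D|%N = 0.
  rewrite /q; under eq_bigr do rewrite flD.
  rewrite -kX -sX -scaler_nat natz gtz0_abs // subrr //.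
have := Pq `|D|%N; rewrite q0 P0 gtz0_abs //.
have -> : \sum_i fl `|D|%N i * P (row i X) = \sum_i k 0 i * P (row i X).
  by apply: eq_bigr => i _; rewrite flD.
move/esym/eqP; rewrite subr_eq0 => /eqP //.
Qed.

(* [X] maximises lexicographically the number of rows in [S] and [|\det X|]. *)
Lemma reduced_rows d (S E : pred 'rV[int]_d) (D : int) :
  (forall X : 'M[int]_d, (forall i, S (row i X) || E (row i X)) -> `|\det X| <= D) ->
  (forall j, E (delta_mx 0 j)) ->
  exists X : 'M[int]_d, [/\ \det X != 0, forall i, S (row i X) || E (row i X)
    & forall s, S s -> forall i, `|(s *m \adj X) 0 i| <= `|\det X| /\
        (S (row i X) \/ (s *m \adj X) 0 i = 0)].
Proof.
move=> hD hE.
(* Determinants are bounded by [D], so the factor [(absz D).+1] lets one more row in [S] outweigh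
   any change of the determinant. *)
pose w (X : 'M[int]_d) := (#|[set i | S (row i X)]| * (absz D).+1 + absz (\det X))%N.
pose adm (X : 'M[int]_d) := \det X != 0 /\ forall i, S (row i X) || E (row i X).
have wle X : adm X -> (w X <= d * (absz D).+1 + absz D)%N.
  case=> _ /hD h; rewrite leq_add ?leq_mul //; last by lia.
  by rewrite -[X in (_ <= X)%N]card_ord max_card.
pose Q n := `[< exists2 X, adm X & w X = n >].
have exQ : exists n, Q n.
  exists (w 1%:M); apply/asboolP; exists 1%:M => //; split; first by rewrite det1.
  by move=> i; rewrite row1 hE orbT.
have bdQ n : Q n -> (n <= d * (absz D).+1 + absz D)%N.
  by move=> /asboolP[X aX <-]; apply: wle.
case: (ex_maxnP exQ bdQ) => n /asboolP[X aX wX] nmax.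
have {nmax} wmax Y : adm Y -> (w Y <= w X)%N.
  by move=> aY; rewrite wX; apply: nmax; apply/asboolP; exists Y.
have [detX rX] := aX.
exists X; split=> // s Ss i.
(* If [Y] is nonsingular it competes with [X]. When row i of [X] is outside [S] the count would
   increase, so the determinant of [Y] must be 0; otherwise the determinant cannot grow. *)
pose Y := \matrix_k (if k == i then s else row k X).
have detY : \det Y = (s *m \adj X) 0 i by apply: det_replace_row.
have rowY k : row k Y = if k == i then s else row k X by rewrite rowK.
have admY : \det Y != 0 -> adm Y.
  by split=> // k; rewrite rowY; case: eqP => _; rewrite ?Ss.
have subXY : [set k | S (row k X)] \subset [set k | S (row k Y)].
  by apply/subsetP => k; rewrite !inE rowY; case: eqP.
rewrite -detY; have [->|Y0] := eqVneq (\det Y) 0.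
  by rewrite normr0 normr_ge0; split=> //; right.
have le := wmax _ (admY Y0); have hX := hD _ rX.
have [Si|Si] := boolP (S (row i X)); last first.
  have : (#|[set k | S (row k X)]| < #|[set k | S (row k Y)]|)%N.
    apply: proper_card; apply/properP; split=> //.
    by exists i; rewrite inE // rowY eqxx.
  move: le; rewrite /w; move: (#|_|) (#|_|) => a b; nia.
split; last by left.
move: (subset_leq_card subXY) le; rewrite /w; move: (#|_|) (#|_|) => a b; nia.
Qed.

Lemma order_preserving_linearization d (U : 'M[int]_d) (N R rho : int)
    (P : 'rV[int]_d -> int) :
  0 < N -> (forall i j, `|U i j| <= N) -> N ^+ d <= `|\det U| * N ->
  0 <= rho <= N -> (d%:Z * 2 + 1) * rho <= R ->
  (forall c c', in_box U R c -> in_box U R c' -> in_box U R (c + c') ->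
     P (c + c') = P c + P c') ->
  (forall c, in_box U rho c -> c != 0 -> P c != 0) ->
  exists f : 'cV[int]_d, forall c, in_box U rho c ->
    `|(c *m f) 0 0| <= (d * d`!)%:Z * N /\ (0 < P c -> 0 < (c *m f) 0 0).
Proof.
move=> N0 hU hdet /andP[rho0 rhoN] hR addP P0.
have detU : 0 < `|\det U|.
  have : 0 < N ^+ d by apply: exprn_gt0.
  nia.
have detU0 : \det U != 0 by rewrite -normr_gt0.
have [S memS] := in_box_enum rho detU0.
(* The points of the box may fail to span; unit vectors complete them. Their images are rows of [U],
   with entries at most N, so they obey the same determinant bound as box points. *)
pose E : pred 'rV[int]_d := fun s => s \in [seq delta_mx 0 j | j : 'I_d].
have hE j : E (delta_mx 0 j) by rewrite /E; apply/imageP; exists j.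
have hD (X : 'M[int]_d) : (forall i, in_box U rho (row i X) || E (row i X)) ->
    `|\det X| <= d`!%:Z * N.
  move=> hX; rewrite -(ler_pM2r detU) -normrM -det_mulmx.
  apply: le_trans (_ : d`!%:R * N ^+ d <= _); last first.
    by rewrite natz -mulrA ler_wpM2l // mulrC.
  apply: normr_det_le => i j.
  have -> : (X *m U) i j = (row i X *m U) 0 j by rewrite -row_mul [RHS]mxE.
  have /orP[/in_boxP h|/imageP[k _ ->]] := hX i; first exact: le_trans (h j) _.
  by rewrite -rowE mxE.
have [X [detX rX redX]] := reduced_rows hD hE.
pose q (s : 'rV[int]_d) : 'rV[rat]_d := map_mx intr s.
(* On a row of [X] outside the box the value is free, because points of the box have coordinate 0
   there; 1 makes the row satisfy its constraint. *)
pose p : 'cV[int]_d := \col_i (if in_box U rho (row i X) then P (row i X) else 1).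
pose X' : 'M[rat]_d := map_mx intr X.
have X'u : X' \in unitmx.
  by rewrite unitmxE det_map_mx unitfE intr_eq0.
pose v0 : 'cV[rat]_d := invmx X' *m map_mx intr p.
have X'v0 : X' *m v0 = map_mx intr p by rewrite mulmxA mulmxV ?mul1mx.
have rowv0 i : (q (row i X) *m v0) 0 0 = (p i 0)%:~R.
  by rewrite /q map_row -row_mul X'v0 !mxE.
have Sv0 s : in_box U rho s -> (q s *m v0) 0 0 = (P s)%:~R.
  move=> sB; pose k := Num.sg (\det X) *: (s *m \adj X).
  have sgD : Num.sg (\det X) * \det X = `|\det X| by rewrite -normrEsg.
  have kX : `|\det X| *: s = k *m X.
    by rewrite -scalemxAl -mulmxA mul_adj_mx mul_mx_scalar scalerA sgD.
  have nk i : `|k 0 i| = `|(s *m \adj X) 0 i|.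
    by rewrite mxE normrM normr_sg detX mul1r.
  have hk i : `|k 0 i| <= `|\det X| /\ (in_box U rho (row i X) \/ k 0 i = 0).
    rewrite nk; have [h1 [h2|h2]] := redX _ sB i; split=> //; first by left.
    by right; apply/eqP; rewrite -normr_eq0 nk h2.
  have Dgt0 : 0 < `|\det X| by rewrite normr_gt0.
  have DP := local_additive_linear addP rho0 hR Dgt0 sB kX hk.
  have D0 : (`|\det X|%:~R : rat) != 0 by rewrite intr_eq0 normr_eq0.
  apply: (mulfI D0); rewrite -rmorphM /= DP.
  have -> : `|\det X|%:~R * (q s *m v0) 0 0 = (q (`|\det X| *: s) *m v0) 0 0.
    by rewrite /q map_mxZ -scalemxAl [in RHS]mxE.
  rewrite kX /q map_mxM -mulmxA X'v0 mxE rmorph_sum; apply: eq_bigr => i _.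
  rewrite !mxE rmorphM /=; case: ifP => // h.
  have [_ [h'|h']] := redX _ sB i; first by rewrite h' in h.
  by move: (nk i); rewrite h' normr0 => /eqP; rewrite normr_eq0 !mxE => /eqP ->; rewrite !mul0r.
(* The rows of [X] outside the box are added to make the constraints span: a row inside the box is a
   constraint up to sign, as [P] does not vanish there. *)
pose T := [seq q s | s <- S & 0 < P s] ++
  [seq q (row i X) | i <- enum 'I_d & ~~ in_box U rho (row i X)].
have Tv0 s : s \in T -> 1 <= (s *m v0) 0 0.
  rewrite mem_cat => /orP[] /mapP[t]; rewrite mem_filter => /andP[ht].
    by rewrite memS => tB ->; rewrite Sv0 // -[1]/(1%:~R) ler_int -gtz0_ge1.
  by move=> _ ->; rewrite rowv0 mxE (negbTE ht).
have spanT (w : 'cV[rat]_d) : (forall s, s \in T -> s *m w = 0) -> w = 0.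
  move=> hw; have : X' *m w = 0.
    apply/row_matrixP => i; rewrite row_mul row0.
    have [hi|hi] := boolP (in_box U rho (row i X)); last first.
      rewrite /X' -map_row; apply: hw; rewrite mem_cat; apply/orP; right.
      by apply/mapP; exists i => //; rewrite mem_filter hi mem_enum.
    have ri : row i X != 0.
      apply: contra_neq detX => ri; rewrite (expand_det_row _ i) big1 // => j _.
      by move/rowP/(_ j): ri; rewrite !mxE => ->; rewrite mul0r.
    have PN : P (- row i X) = - P (row i X).
      have rhoR : rho <= R by nia.
      have b1 := in_box_le rhoR hi.
      have b0 : in_box U R 0 by apply: in_box0; lia.
      have := addP 0 0; rewrite addr0 => /(_ b0 b0 b0) h0.
      have := addP (row i X) (- row i X); rewrite in_boxN subrr => /(_ b1 b1 b0) h1.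
      by move: h0 h1; move: (P 0) (P (row i X)) (P (- row i X)) => *; lia.
    have hpos s : in_box U rho s -> 0 < P s -> q s *m w = 0.
      move=> sB Ps; apply: hw; rewrite mem_cat; apply/orP; left.
      by apply/mapP; exists s => //; rewrite mem_filter Ps memS.
    have [lt|gt|eq] := ltgtP (P (row i X)) 0; last by have := P0 _ hi ri; rewrite eq.
      have := hpos (- row i X); rewrite in_boxN PN oppr_gt0 => /(_ hi lt).
      by rewrite /q map_mxN mulNmx => /eqP; rewrite oppr_eq0 map_row => /eqP.
    by rewrite -map_row; apply: hpos.
  by move/(congr1 (mulmx (invmx X'))); rewrite mulmxA mulVmx // mul1mx mulmx0.
have [Y' [v [Yrows Yfree Yv vT]]] := polyhedron_partial_vertex Tv0 spanT (leqnn d).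
have [Y [YE Ybox]] : exists Y : 'M[int]_d,
    map_mx intr Y = Y' /\ forall i, in_box U rho (row i Y) || E (row i Y).
  have h i : exists s, q s = row i Y' /\ (in_box U rho s || E s).
    have := Yrows i; rewrite mem_cat => /orP[] /mapP[t]; rewrite mem_filter => /andP[ht].
      by rewrite memS => tB ->; exists t; rewrite tB.
    by move=> _ ->; exists (row t X).
  have [g hg] := choice h; exists (\matrix_i g i); split.
    by apply/row_matrixP => i; have [<- _] := hg i; rewrite -map_row rowK.
  by move=> i; rewrite rowK; have [] := hg i.
have detY : (\det Y)%:~R != 0 :> rat.
  by rewrite -det_map_mx YE -unitfE -unitmxE -row_free_unit.
(* With [Y] the matrix of tight constraints, this is |\det Y| times the vertex, hence integral. Its
   value at [c] is, up to sign, the sum over i of the determinants of [Y] with row i replaced by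
   [c], which gives d d! N. *)
exists (Num.sg (\det Y) *: (\adj Y *m const_mx 1)) => c cB.
rewrite -scalemxAr mulmxA; split.
  rewrite mxE normrM normr_sg; move: detY; rewrite intr_eq0 => ->; rewrite mul1r.
  rewrite mxE; apply: le_trans (ler_norm_sum _ _ _) _.
  have -> : (d * d`!)%:Z * N = \sum_(i < d) d`!%:Z * N.
    by rewrite sumr_const card_ord -mulr_natl natz PoszM mulrA.
  apply: ler_sum => i _; rewrite [const_mx _ _ _]mxE mulr1 -det_replace_row; apply: hD => k.
  by rewrite rowK; case: eqP => // _; rewrite cB.
move=> Pc; have cv : 1 <= (q c *m v) 0 0.
  apply: vT; rewrite mem_cat; apply/orP; left.
  by apply/mapP; exists c => //; rewrite mem_filter Pc memS.
rewrite -(ltr0z rat).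
have -> : ((Num.sg (\det Y) *: (c *m \adj Y *m (const_mx 1 : 'cV_d))) 0 0)%:~R
    = `|\det Y|%:~R * (q c *m v) 0 0 :> rat.
  have -> : `|\det Y| = Num.sg (\det Y) * \det Y by rewrite -normrEsg.
  rewrite mxE !intrM -mulrA; congr (_ * _).
  have -> : ((c *m \adj Y *m (const_mx 1 : 'cV_d)) 0 0)%:~R =
      (map_mx intr (c *m \adj Y *m const_mx 1) : 'M[rat]_1) 0 0.
    by rewrite [RHS]mxE.
  rewrite !map_mxM map_const_mx -Yv -YE -mulmxA [_ *m (_ *m v)]mulmxA -map_mxM mul_adj_mx.
  by rewrite map_scalar_mx mul_scalar_mx -scalemxAr [LHS]mxE.
rewrite mulr_gt0 //; last exact: lt_le_trans cv.
by rewrite ltr0z normr_gt0 -(intr_eq0 rat).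
Qed.

(** * Bohr sets *)

(** Double counting: as t runs over A - P, the sizes of the sets of a with a - t in [P] sum to |A|
    |P|, so some t does at least as well as the average. *)
Lemma popular_translate (A P : {fset int}) : A != fset0 -> P != fset0 ->
  exists t, (#|` A| * #|` P| <=
    #|` sumset A (oppset P)| * #|` [fset a in A | (a - t)%R \in P]|)%N.
Proof.
move=> A0 P0; pose T := sumset A (oppset P); pose At t := [fset a in A | (a - t)%R \in P].
have memT a p : a \in A -> p \in P -> a - p \in T.
  by move=> aA pP; apply: mem_sumset; rewrite ?mem_oppset ?opprK.
have sumT : (\sum_(t <- T) #|` At t| = #|` A| * #|` P|)%N.
  have -> : (#|` A| * #|` P| = \sum_(a <- A) \sum_(p <- P) 1)%N.
    by rewrite sum1_size big_const_seq count_predT iter_addn_0 mulnC.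
  have cardAt t : #|` At t| = (\sum_(a <- A) ((a - t)%R \in P))%N.
    rewrite -big_mkcond sum1_count -size_filter; apply/perm_size/uniq_perm.
    - exact: fset_uniq.
    - exact/filter_uniq/fset_uniq.
    by move=> a; rewrite mem_filter !inE /= andbC.
  under eq_bigr do rewrite cardAt.
  rewrite exchange_big /= big_seq [RHS]big_seq; apply: eq_bigr => a aA.
  rewrite sum1_size -[LHS]big_mkcond sum1_count -size_filter -(size_map (fun t => a - t)).
  apply/perm_size/uniq_perm; rewrite ?fset_uniq //.
    rewrite map_inj_uniq ?filter_uniq ?fset_uniq // => x y /addrI/oppr_inj //.
  move=> p; apply/mapP/idP => [[t]|pP]; first by rewrite mem_filter => /andP[+ _] ->.
  by exists (a - p); rewrite ?mem_filter opprB addrC subrK // pP memT.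
have [a aA] := fset0Pn _ A0; have [p pP] := fset0Pn _ P0.
apply: contrapT => hn.
have h t : (#|` T| * #|` At t| < #|` A| * #|` P|)%N.
  by rewrite ltnNge; apply/negP => le; apply: hn; exists t.
have : (#|` T| * (#|` A| * #|` P|) < #|` T| * (#|` A| * #|` P|))%N.
  rewrite -{1}sumT big_distrr /=.
  have -> : (#|` T| * (#|` A| * #|` P|) = \sum_(t <- T) (#|` A| * #|` P|))%N.
    by rewrite big_const_seq count_predT iter_addn_0 mulnC.
  have : (\sum_(t <- T) (#|` T| * #|` At t|).+1 <= \sum_(t <- T) (#|` A| * #|` P|))%N.
    by exact: leq_sum.
  apply: leq_trans; under [leqRHS]eq_bigr do rewrite -addn1.
  rewrite big_split /= sum1_size -addn1 leq_add2l cardfs_gt0; apply/fset0Pn.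
  by exists (a - p); apply: memT.
by rewrite ltnn.
Qed.

(* With [r] a row of frequencies, [(x, w) *m bohr_mx N r = (x, x r + N w)]: a short
   vector is an element [x] of the Bohr set of [(1, r)], together with the multiples
   of [N] that bring the [x r_j] close to 0. *)
Definition bohr_mx (g N : nat) (r : 'rV[int]_g) : 'M[int]_(1 + g) :=
  block_mx 1%:M r 0 N%:R%:M.

Lemma bohr_mx_box g N (r : 'rV[int]_g) (rho : int) (c : 'rV[int]_(1 + g)) :
  reflect (`|c 0 0| <= rho /\
     forall j, `|r 0 j * c 0 0 + N%:Z * c 0 (rshift 1 j)| <= rho)
    (in_box (bohr_mx N r) rho c).
Proof.
have e0 : (c *m bohr_mx N r) 0 (lshift g 0) = c 0 0.
  rewrite -[c in LHS]hsubmxK mul_row_block row_mxEl mulmx1 mulmx0 addr0 mxE.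
  by congr (c 0 _); apply: val_inj.
have e1 j : (c *m bohr_mx N r) 0 (rshift 1 j) = r 0 j * c 0 0 + N%:Z * c 0 (rshift 1 j).
  rewrite -[c in LHS]hsubmxK mul_row_block row_mxEr mxE mul_mx_scalar mxE big_ord1 !mxE natz.
  by rewrite mulrC; congr (_ * c 0 _ + _); apply: val_inj.
apply: (iffP (in_boxP _ _ _)) => [h|[h0 h1] j].
  split; first by rewrite -e0.
  by move=> j; rewrite -e1.
case: (split_ordP j) => i ->; last by rewrite e1.
by rewrite ord1 e0.
Qed.

Lemma det_bohr_mx g N (r : 'rV[int]_g) : \det (bohr_mx N r) = N%:Z ^+ g.
Proof. by rewrite det_ublock det1 mul1r det_scalar natz. Qed.

(** Pigeonhole: the vectors (x, r_1 x, ..., r_g x) modulo N, for 0 <= x < N, fall into K^(g+1) cubes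
    of side N / K. Differences with a fixed point of the most popular cube are short lattice
    vectors. *)
Lemma bohr_count g N K (r : 'rV[int]_g) : (0 < N)%N -> (0 < K)%N ->
  exists L : {fset 'rV[int]_(1 + g)}, (N <= K ^ g.+1 * #|` L|)%N /\
    {in L, forall c, in_box (bohr_mx N r) (N %/ K)%N%:Z c}.
Proof.
move=> N0 K0.
pose rr (j : 'I_g.+1) : int := if unlift 0 j is Some i then r 0 i else 1.
pose res x j : int := modz (rr j * x) N.
pose cell (x : int) : {ffun 'I_g.+1 -> 'I_K.-1.+1} :=
  [ffun j => inord (absz (divz (K%:Z * res x j) N%:Z))].
pose f x := val (enum_rank (cell x)).
pose X : {fset int} := [fset (i%:Z : int) | i in iota 0 N].
have cX : #|` X| = N.
  by rewrite card_in_imfset /= => [|? ? _ _ []//]; rewrite undup_id ?iota_uniq ?size_iota.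
have cF : #|{ffun 'I_g.+1 -> 'I_K.-1.+1}| = (K ^ g.+1)%N.
  by rewrite card_ffun !card_ord prednK.
have fX : {in X, forall x, f x < K ^ g.+1}%N.
  by move=> x _; rewrite /f -cF; apply: ltn_ord.
have [|i] := pigeonhole_fset _ fX; first by rewrite expn_gt0 K0.
set Y := [fset _ in _ | _] => hY.
have [Y0|] := eqVneq Y fset0; first by move: hY; rewrite Y0 cardfs0 cX; lia.
move=> /fset0Pn[x0 x0Y].
(* The quotients are such that r_i (x - x0) + N w_i is the difference of the residues of r_i x and
   r_i x0. The entry x - x0 makes [h] injective. *)
pose h (x : int) : 'rV[int]_(1 + g) :=
  \row_j (if unlift (0 : 'I_g.+1) j is Some i then
            divz (r 0 i * x0) N - divz (r 0 i * x) N else x - x0).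
have h_inj : injective h.
  by move=> x y /rowP/(_ 0); rewrite !mxE unlift_none => /addIr.
exists [fset h x | x in Y]; split.
  by rewrite card_imfset //=; move: hY; rewrite cX.
move=> _ /imfsetP[x /= xY ->].
have close j : `|res x j - res x0 j| <= (N %/ K)%N%:Z.
  have : cell x = cell x0.
    move: xY x0Y; rewrite !inE => /andP[_ /eqP ex] /andP[_ /eqP ex0].
    by apply/enum_rank_inj/val_inj; rewrite -[LHS]/(f x) -[RHS]/(f x0) ex ex0.
  move=> /ffunP/(_ j); rewrite !ffunE => /(congr1 (@nat_of_ord _)).
  have bound y : 0 <= res y j < N%:Z by rewrite /res modz_ge0 ?ltz_pmod //; lia.
  pose dv y := divz (K%:Z * res y j) N.
  have Nz : 0 < N%:Z by lia.
  have dP y : dv y * N%:Z <= K%:Z * res y j < (dv y + 1) * N%:Z.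
    by rewrite lez_floor ?gt_eqF //= ltz_ceil.
  rewrite -!/(dv _).
  have dv_lt y : (absz (dv y) < K.-1.+1)%N.
    rewrite prednK //; have := bound y; have := dP y.
    move: (dv y) (res y j) => a b; clear -N0 K0; nia.
  rewrite !inordK //; have := bound x; have := bound x0; have := dP x; have := dP x0.
  have := ltn_ceil N K0; move: (N %/ K)%N (dv x) (dv x0) (res x j) (res x0 j) => q a b u v.
  clear -N0 K0; nia.
apply/bohr_mx_box; rewrite !mxE.
have -> : unlift (0 : 'I_g.+1) 0 = None by rewrite unlift_none.
split.
  have := close 0; rewrite /res /rr unlift_none !mul1r.
  move: xY x0Y; rewrite !inE => /andP[/imfsetP[a /= + ->] _] /andP[/imfsetP[b /= + ->] _].
  rewrite !mem_iota /= !add0n => ha hb.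
  by rewrite !modz_small // ?le0z_nat ?ltz_nat.
move=> j; rewrite mxE.
have -> : rshift 1 j = lift (0 : 'I_g.+1) j by apply: val_inj.
rewrite liftK; have := close (lift 0 j); rewrite /res /rr liftK.
have := divz_eq (r 0 j * x) N; have := divz_eq (r 0 j * x0) N.
by rewrite !mulrBr; move: (modz _ _) (modz _ _) (divz _ _) (divz _ _) => a b c' d'; lia.
Qed.

Lemma bohr_lift (R : realType) (A : {fset int}) (k : nat) : A != fset0 ->
  (#|` sumset A A| <= k * #|` A|)%N ->
  exists (N g : nat) (r : 'rV[int]_g) (P : 'rV[int]_(1 + g) -> int),
  [/\ (#|` A| <= N)%N, (g <= (18 * k ^ 12) ^ 2)%N,
     forall j, 0 <= r 0 j < N%:Z &
     forall rho, 4 * rho <= N%:Z ->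
     [/\ forall c c', in_box (bohr_mx N r) rho c -> in_box (bohr_mx N r) rho c' ->
         in_box (bohr_mx N r) rho (c + c') -> P (c + c') = P c + P c',
       forall c, in_box (bohr_mx N r) rho c -> c != 0 -> P c != 0 &
       forall c, in_box (bohr_mx N r) rho c ->
         exists a1 a2 a3 a4, [/\ a1 \in A, a2 \in A, a3 \in A & a4 \in A] /\
           P c = a1 + a2 - (a3 + a4)]].
Proof.
move=> A0 hA; pose D := sumset (nsum 6 A) (oppset (nsum 6 A)).
have cA0 : (0 < #|` A|)%N by rewrite cardfs_gt0.
have [a0 a0A] := fset0Pn _ A0.
have cD : (#|` D| <= k ^ 12 * #|` A|)%N by apply: plunnecke_ruzsa.
have AD : (#|` A| <= #|` D|)%N.
  rewrite -(card_sumset1 (- a0) A); apply: fsubset_leq_card; apply/fsubsetP => x /sumsetP[b].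
  rewrite inE => /eqP -> [a aA ->].
  have -> : - a0 + a = \sum_(x <- a :: nseq 5 a0) x + - \sum_(x <- nseq 6 a0) x.
    by rewrite !big_cons big_nil; ring.
  have nA n : {subset nseq n a0 <= A} by move=> y /nseqP[->].
  apply: mem_sumset; last by rewrite mem_oppset opprK (mem_nsum (nA 6)).
  by apply: (@mem_nsum A (a :: nseq 5 a0)) => y; rewrite inE => /predU1P[->|/nA].
pose N := (2 * #|` D|).+1.
have [A1 [F [A1A cA1 FP]]] := @ruzsa_model A 6 N isT (leqnn _).
have cA1_gt0 : (0 < #|` A1|)%N by lia.
have F_inj : {in A1 &, forall a b, (N %| F a - F b)%Z -> a = b}.
  move=> a b aA bA h.
  have nA c : c \in A1 -> {subset nseq 6 c <= A1} by move=> cA y /nseqP[->].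
  have := FP (nseq 6 a) (nseq 6 b) (nA _ aA) (nA _ bA); rewrite !size_nseq => /(_ erefl erefl)[_].
  rewrite !big_cons !big_nil => e.
  have : (N %| 6 * (F a - F b))%Z by apply: dvdz_mull.
  rewrite (_ : 6 * _ = (F a + (F a + (F a + (F a + (F a + (F a + 0)))))) -
     (F b + (F b + (F b + (F b + (F b + (F b + 0))))))); last by ring.
  by move=> /e; clear; lia.
pose B := [seq F a | a <- A1].
have N0 : (0 < N)%N by [].
have uB : uniq B.
  rewrite map_inj_in_uniq ?fset_uniq // => a b aA bA e.
  by apply: F_inj => //; rewrite e subrr dvdz0.
have B0 : (0 < size B)%N by rewrite size_map.
have injB : {in B &, forall x y, (N %| x - y)%Z -> x = y}.
  by move=> _ _ /mapP[a aA ->] /mapP[b bA ->] h; rewrite (F_inj _ _ aA bA h).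
have [G [cG Grange Gbohr]] := bogolyubov R N0 uB B0 injB.
rewrite size_map in cG.
exists N, (size G), (\row_j nth 0 G j).
pose quad (c : 'rV[int]_(1 + size G)) (p : (int * int) * (int * int)) :=
  [/\ p.1.1 \in A1, p.1.2 \in A1, p.2.1 \in A1 & p.2.2 \in A1] /\
  (N %| F p.1.1 + F p.1.2 - (F p.2.1 + F p.2.2) - (c 0 0)%R)%Z.
(* One quadruple serves all admissible [rho] at once, since [P] is later used on two boxes of
   different radii. Outside them it is a dummy. *)
have quadP c : exists p, forall rho, 4 * rho <= N%:Z ->
    in_box (bohr_mx N (\row_j nth 0 G j)) rho c -> quad c p.
  have [[rho [hrho hc]]|h] := pselect (exists rho, 4 * rho <= N%:Z /\
      in_box (bohr_mx N (\row_j nth 0 G j)) rho c); last first.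
    by exists ((0, 0), (0, 0)) => rho hrho hc; case: h; exists rho.
  have [|x [y [z [t]]]] := Gbohr (c 0 0).
    move=> r /(nthP 0)[j jG <-]; exists (c 0 (rshift 1 (Ordinal jG))).
    have /bohr_mx_box[_ /(_ (Ordinal jG))] := hc; rewrite mxE => hj.
    by rewrite normrM; apply: le_trans hrho; rewrite ler_pM2l.
  case=> /mapP[a aA ->] /mapP[b bA ->] /mapP[a' aA' ->] /mapP[b' bA' ->] h.
  by exists ((a, a'), (b, b')).
have [q hq] := choice quadP.
exists (fun c => (q c).1.1 + (q c).1.2 - ((q c).2.1 + (q c).2.2)); split.
- by rewrite /N; lia.
(* N = 2 |D| + 1 <= 3 |D| <= 3 k^12 |A| <= 18 k^12 |A1|: the 12 comes from 6A - 6A, and 18 = 3 * 6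
   from the loss |A| <= 6 |A1|. *)
- have cG' : (size G * #|` A1| ^ 2 <= (18 * k ^ 12) ^ 2 * #|` A1| ^ 2)%N.
    apply: leq_trans cG _; rewrite -expnMn leq_exp2r //.
    have k0 : (0 < k ^ 12 * #|` A|)%N by apply: leq_trans cD; lia.
    rewrite /N; move: (k ^ 12)%N cD k0 cA1 => kk; clear; nia.
  by rewrite leq_pmul2r ?expn_gt0 ?cA1_gt0 in cG'.
- by move=> j; rewrite mxE; apply: Grange; apply: mem_nth.
move=> rho hrho; split.
- move=> c c' cB cB' ccB.
  have := hq _ _ hrho cB; have := hq _ _ hrho cB'; have := hq _ _ hrho ccB.
  move: (q c) (q c') (q (c + c')) => [[a1 a2] [a3 a4]] [[b1 b2] [b3 b4]] [[d1 d2] [d3 d4]].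
  move=> [/= [d1A d2A d3A d4A] hd] [/= [b1A b2A b3A b4A] hb] [/= [a1A a2A a3A a4A] ha].
  have sub (x1 x2 x3 x4 x5 x6 : int) : x1 \in A1 -> x2 \in A1 -> x3 \in A1 -> x4 \in A1 ->
      x5 \in A1 -> x6 \in A1 -> {subset [:: x1; x2; x3; x4; x5; x6] <= A1}.
    by move=> *; apply/allP; rewrite /=; do ?(apply/andP; split).
  have [_ e] := FP [:: a1; a2; b1; b2; d3; d4] [:: a3; a4; b3; b4; d1; d2]
    (sub _ _ _ _ _ _ a1A a2A b1A b2A d3A d4A) (sub _ _ _ _ _ _ a3A a4A b3A b4A d1A d2A) erefl erefl.
  move: e; rewrite !big_cons !big_nil => e.
  have /e : (N %| F a1 + (F a2 + (F b1 + (F b2 + (F d3 + (F d4 + 0))))) -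
     (F a3 + (F a4 + (F b3 + (F b4 + (F d1 + (F d2 + 0)))))))%Z.
    rewrite mxE in hd.
    rewrite (_ : F a1 + _ - _ =
       (F a1 + F a2 - (F a3 + F a4) - c 0 0) + (F b1 + F b2 - (F b3 + F b4) - c' 0 0) -
       (F d1 + F d2 - (F d3 + F d4) - (c 0 0 + c' 0 0))); last by ring.
    exact: rpredB (rpredD ha hb) hd.
  by clear; lia.
- move=> c cB c0; have := hq _ _ hrho cB.
  move: (q c) => [[a1 a2] [a3 a4]] /= [[a1A a2A a3A a4A] ha].
  apply: contraNneq c0 => e.
  have sub (x1 x2 : int) : x1 \in A1 -> x2 \in A1 -> {subset [:: x1; x2; a1; a1; a1; a1] <= A1}.
    by move=> *; apply/allP; rewrite /=; do ?(apply/andP; split).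
  (* Padding with [a1] turns a relation between sums of two into one between sums of six. It yields
     N | c_0, so c_0 = 0 as |c_0| <= N / 4; the other coordinates follow. *)
  have [e' _] := FP [:: a1; a2; a1; a1; a1; a1] [:: a3; a4; a1; a1; a1; a1]
    (sub _ _ a1A a2A) (sub _ _ a3A a4A) erefl erefl.
  move: e'; rewrite !big_cons !big_nil => e'.
  have {e'} h : (N %| F a1 + F a2 - (F a3 + F a4))%Z.
    rewrite (_ : F a1 + F a2 - _ = F a1 + (F a2 + (F a1 + (F a1 + (F a1 + (F a1 + 0))))) -
       (F a3 + (F a4 + (F a1 + (F a1 + (F a1 + (F a1 + 0))))))); last by ring.
    by apply: e'; move: e; clear; lia.
  have hx : (N %| (c 0 0)%R)%Z by have := rpredB h ha; rewrite opprB addrC subrK.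
  have small (z : int) : (N %| z)%Z -> `|z| <= rho -> z = 0.
    move=> /dvdzP[w ->] hz; have [->|w0] := eqVneq w 0; first by rewrite mul0r.
    by exfalso; move: w0 hz hrho N0; clear; move: N => n; nia.
  have /bohr_mx_box[hc0 hcj] := cB.
  have c00 := small _ hx hc0.
  apply/eqP/rowP => j; rewrite [RHS]mxE; case: (split_ordP j) => i ->.
    by rewrite ord1 -[RHS]c00; congr (c 0 _); apply: val_inj.
  have := hcj i; rewrite c00 mulr0 add0r => /(small _ (dvdz_mulr _ (dvdzz _))) /eqP.
  by rewrite mulf_eq0 => /orP[//|/eqP].
move=> c cB; have := hq _ _ hrho cB; move: (q c) => [[a1 a2] [a3 a4]] /= [[a1A a2A a3A a4A] _].
by exists a1, a2, a3, a4; split=> //; split; apply: (fsubsetP A1A).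
Qed.

(** * Order-preserving models *)

Lemma bohr_mx_le g N (r : 'rV[int]_g) : (0 < N)%N ->
  (forall j, 0 <= r 0 j < N%:Z) -> forall i j, `|bohr_mx N r i j| <= N%:Z.
Proof.
move=> N0 rN i j; rewrite /bohr_mx; have N1 : 1 <= N%:Z by rewrite lez_nat.
case: (split_ordP i) => i' ->; case: (split_ordP j) => j' ->.
- by rewrite block_mxEul !ord1 mxE normr1.
- by rewrite block_mxEur ord1; have /andP[? ?] := rN j'; rewrite ger0_norm // ltW.
- by rewrite block_mxEdl mxE normr0.
by rewrite block_mxEdr mxE; case: eqP => _; rewrite ?mulr1n ?mulr0n ?normr0 // natz ger0_norm.
Qed.

Lemma ordered_model (R : realType) (k : nat) : exists C : nat, forall A : {fset int},
  A != fset0 -> (#|` sumset A A| <= k * #|` A|)%N ->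
  exists (A' : {fset int}) (phi : int -> int),
    [/\ A' `<=` A, (#|` A| <= C * #|` A'|)%N,
        {in A' &, forall a b, phi a < phi b <-> a < b},
        forall a b c d, a \in A' -> b \in A' -> c \in A' -> d \in A' ->
          phi a + phi b = phi c + phi d <-> a + b = c + d &
        {in A', forall x, `|phi x| <= (C * #|` A'|)%N%:Z}].
Proof.
pose g0 := ((18 * k ^ 12) ^ 2)%N; pose d0 := g0.+1.
(* Relations between four lifts need radius 4 rho', linearity a further factor 2 d + 1, and
   [bohr_lift] a radius at most N / 4: hence 16. [C0] combines K^d from [bohr_count] with k^5, as A
   - P(L) lies in 3A - 2A. The index 0 marks bounds depending on [k] alone. *)
pose K0 := (16 * (d0 * 2 + 1))%N; pose C0 := (K0 ^ d0 * k ^ 5)%N.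
exists (d0 * d0`! * C0)%N => A A0 hA.
have [N [g [r [P [AN gle rN hP]]]]] := bohr_lift R A0 hA.
have N0 : (0 < N)%N by apply: leq_trans AN; rewrite cardfs_gt0.
pose d := g.+1; pose K := (16 * (d * 2 + 1))%N.
have dd0 : (d <= d0)%N by [].
have KK0 : (K <= K0)%N by rewrite /K /K0 leq_mul2l leq_add2r leq_mul2r dd0.
have K_gt0 : (0 < K)%N by rewrite muln_gt0 addn1.
have [L [NL Lbox]] := bohr_count r N0 K_gt0.
set rho' := (N %/ K)%N%:Z in Lbox; pose rho := 4 * rho'.
have rho0 : 0 <= rho' by [].
have Krho : (16 * (d%:Z * 2 + 1)) * rho' <= N%:Z.
  have := leq_trunc_div N K; rewrite mulnC /rho' {1}/K => h.
  by move: h; rewrite -lez_nat !PoszM PoszD PoszM.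
have rhoR : rho <= (d%:Z * 2 + 1) * rho by rewrite /rho; clear -rho0; nia.
have [addP _ _] := hP ((d%:Z * 2 + 1) * rho) ltac:(rewrite /rho; lia).
have [_ P0 Pquad] := hP rho ltac:(rewrite /rho; clear -rho0 Krho; nia).
have [||||f hf] :=
  @order_preserving_linearization d (bohr_mx N r) N _ rho P _ _ _ _ (lexx _) addP P0.
- by rewrite ltz_nat.
- exact: bohr_mx_le.
- by rewrite det_bohr_mx normrX ger0_norm // -exprSr.
- by rewrite /rho; clear -rho0 Krho; nia.
have rho_ge0 : 0 <= rho by rewrite mulr_ge0.
have l2 : rho' + rho' <= rho by rewrite /rho; clear -rho0; lia.
have l3 : rho' + rho' + rho' <= rho by rewrite /rho; clear -rho0; lia.
have l4 : rho' + rho' + (rho' + rho') <= rho by rewrite /rho; clear -rho0; lia.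
have l1 : rho' <= rho by apply: le_trans l2; rewrite lerDl.
have boxB rho1 rho2 c c' : in_box (bohr_mx N r) rho1 c -> in_box (bohr_mx N r) rho2 c' ->
    in_box (bohr_mx N r) (rho1 + rho2) (c - c').
  by move=> h h'; apply: in_boxD => //; rewrite in_boxN.
have bR rho1 c : rho1 <= rho -> in_box (bohr_mx N r) rho1 c ->
    in_box (bohr_mx N r) ((d%:Z * 2 + 1) * rho) c.
  by move=> h; apply: in_box_le; apply: le_trans rhoR.
have PD rho1 rho2 c c' : 0 <= rho1 -> 0 <= rho2 -> rho1 + rho2 <= rho ->
    in_box (bohr_mx N r) rho1 c -> in_box (bohr_mx N r) rho2 c' ->
    P (c + c') = P c + P c'.
  move=> h1 h2 h12 b1 b2.
  apply: addP; [apply: bR b1|apply: bR b2|apply: bR (in_boxD b1 b2)] => //;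
    clear -h1 h2 h12; lia.
have PB rho1 rho2 c c' : 0 <= rho1 -> 0 <= rho2 -> rho1 + rho2 + rho2 <= rho ->
    in_box (bohr_mx N r) rho1 c -> in_box (bohr_mx N r) rho2 c' ->
    P (c - c') = P c - P c'.
  move=> h1 h2 h12 b1 b2; apply/eqP; rewrite eq_sym subr_eq eq_sym; apply/eqP.
  by rewrite -(PD (rho1 + rho2) rho2) ?subrK ?addr_ge0 //; apply: boxB.
pose Phi (c : 'rV[int]_d) := (c *m f) 0 0.
have PhiB c c' : Phi (c - c') = Phi c - Phi c' by rewrite /Phi mulmxBl !mxE.
have PhiD c c' : Phi (c + c') = Phi c + Phi c' by rewrite /Phi mulmxDl mxE.
have Ppos c : in_box (bohr_mx N r) rho c -> 0 < P c -> 0 < Phi c by move=> /hf[].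
have P00 : P 0 = 0.
  have b0 : in_box (bohr_mx N r) 0 0 by apply: in_box0.
  have := @PD 0 0 0 0 (lexx _) (lexx _); rewrite !addr0 => /(_ rho_ge0 b0 b0) h; clear -h; lia.
have PN c : in_box (bohr_mx N r) rho c -> P (- c) = - P c.
  move=> b; have := addP c (- c); rewrite subrr in_boxN P00.
  move=> /(_ (bR _ _ (lexx _) b) (bR _ _ (lexx _) b) (bR 0 _ rho_ge0 (in_box0 _ (lexx _)))) h.
  by clear -h; lia.
have Pneg c : in_box (bohr_mx N r) rho c -> P c < 0 -> Phi c < 0.
  move=> b neg; have := Ppos (- c); rewrite in_boxN PN // oppr_gt0 => /(_ b neg).
  by rewrite /Phi mulNmx mxE oppr_gt0.
have Pzero c : in_box (bohr_mx N r) rho c -> P c = 0 -> Phi c = 0.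
  move=> b /eqP z; have [->|c0] := eqVneq c 0; first by rewrite /Phi mul0mx mxE.
  by have := P0 c b c0; rewrite z.
have PhiE0 c : in_box (bohr_mx N r) rho c -> Phi c = 0 <-> P c = 0.
  move=> b; split; last exact: Pzero.
  have [/(Pneg _ b)|/(Ppos _ b)|//] := ltgtP (P c) 0; clear; lia.
have Phi_lt0 c : in_box (bohr_mx N r) rho c -> Phi c < 0 <-> P c < 0.
  move=> b; split; last exact: Pneg.
  have [//|/(Ppos _ b)|/(Pzero _ b)] := ltgtP (P c) 0; clear; lia.
have P_inj : {in L &, injective P}.
  move=> c c' cL c'L e; apply/eqP; rewrite -subr_eq0; apply: contraT => ne.
  have b : in_box (bohr_mx N r) (rho' + rho') (c - c') by apply: boxB; apply: Lbox.
  by have := P0 (c - c') (in_box_le l2 b) ne; rewrite (PB rho' rho') ?Lbox // e subrr eqxx.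
pose PL := [fset P c | c in L].
have cPL : #|` PL| = #|` L| by rewrite card_in_imfset.
have cL0 : (0 < #|` L|)%N by move: NL N0; clear; nia.
have PL0 : PL != fset0 by rewrite -cardfs_gt0 cPL.
have [t ht] := popular_translate A0 PL0.
set A' := [fset _ in _ | _] in ht.
have cA : (#|` sumset A (oppset PL)| <= k ^ 5 * #|` A|)%N.
  apply: leq_trans (plunnecke_ruzsa 3 2 A0 hA); apply: fsubset_leq_card.
  apply/fsubsetP => x /sumsetP[a aA [p]]; rewrite mem_oppset => /imfsetP[c /= cL Pc ->].
  have [|a1 [a2 [a3 [a4 [[a1A a2A a3A a4A] e]]]]] := Pquad c.
    exact: in_box_le (Lbox _ cL).
  have -> : a + p = \sum_(x <- [:: a; a3; a4]) x + - \sum_(x <- [:: a1; a2]) x.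
    by rewrite !big_cons big_nil; rewrite -[p]opprK Pc e; ring.
  apply: mem_sumset.
    by apply: (@mem_nsum A [:: a; a3; a4]); apply/allP; rewrite /= aA a3A a4A.
  rewrite mem_oppset opprK.
  by apply: (@mem_nsum A [:: a1; a2]); apply/allP; rewrite /= a1A a2A.
have cLA' : (#|` L| <= k ^ 5 * #|` A'|)%N.
  move: ht cA; rewrite cPL; have : (0 < #|` A|)%N by rewrite cardfs_gt0.
  move: (k ^ 5)%N #|` A| #|` L| #|` A'| #|` sumset A _| => kk a l a' s; clear.
  move=> a_gt0 h1 h2; rewrite -(leq_pmul2l a_gt0); apply: leq_trans h1 _.
  by rewrite mulnA [(a * kk)%N]mulnC leq_mul2r h2 orbT.
have NA' : (N <= C0 * #|` A'|)%N.
  apply: leq_trans NL _; rewrite /C0 -mulnA leq_mul //.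
  apply: leq_trans (_ : K0 ^ d <= _)%N; first by rewrite leq_exp2r.
  by rewrite leq_exp2l // /K0; clear; lia.
(* Lifts of a - t to [L]; the shift t cancels in all the differences considered below. *)
have yP a : exists y, a \in A' -> y \in L /\ P y = a - t.
  have [aA'|] := boolP (a \in A'); last by exists 0.
  move: (aA'); rewrite !inE => /andP[_ /imfsetP[y /= yL e]]; by exists y.
have [y hy] := choice yP.
have ybox a : a \in A' -> in_box (bohr_mx N r) rho' (y a) by move=> /hy[/Lbox].
have Py a : a \in A' -> P (y a) = a - t by move=> /hy[].
exists A', (fun a => Phi (y a)); split.
- by apply/fsubsetP => x; rewrite !inE => /andP[].
- apply: leq_trans AN (leq_trans NA' _); rewrite leq_mul2r leq_pmull ?orbT //.
  by rewrite muln_gt0 fact_gt0.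
- move=> a b aA bA.
  have bx : in_box (bohr_mx N r) rho (y a - y b).
    exact: in_box_le l2 (boxB _ _ _ _ (ybox _ aA) (ybox _ bA)).
  have := Phi_lt0 _ bx; rewrite PhiB (PB rho' rho') ?ybox // ?Py //.
  by rewrite subr_lt0 opprB addrA subrK subr_lt0.
- move=> a b c e aA bA cA' eA.
  have bab := in_boxD (ybox _ aA) (ybox _ bA).
  have bce := in_boxD (ybox _ cA') (ybox _ eA).
  (* A relation between four elements lives at radius 4 rho' = rho, where [P] and [Phi] vanish
     together. *)
  have bx : in_box (bohr_mx N r) rho (y a + y b - (y c + y e)).
    exact: in_box_le l4 (boxB _ _ _ _ bab bce).
  have := PhiE0 _ bx; rewrite PhiB !PhiD.
  have -> : P (y a + y b - (y c + y e)) = a + b - (c + e).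
    have := addP (y a + y b - (y c + y e)) (y c + y e); rewrite subrK.
    rewrite (PD rho' rho' (y a) (y b)) ?ybox // (PD rho' rho' (y c) (y e)) ?ybox // !Py //.
    move=> /(_ (bR _ _ (lexx _) bx) (bR _ _ l2 bce) (bR _ _ l2 bab)); clear; lia.
  case=> h1 h2; split=> h.
    by apply/eqP; rewrite -subr_eq0; apply/eqP/h1; rewrite h subrr.
  by apply/eqP; rewrite -subr_eq0; apply/eqP/h2; rewrite h subrr.
move=> a aA; have [h _] := hf _ (in_box_le l1 (ybox _ aA)).
apply: le_trans h _; rewrite -PoszM lez_nat -[(_ * C0 * _)%N]mulnA leq_mul //.
by rewrite leq_mul //; apply: leq_fact.
Qed.

Local Close Scope fset_scope.

Theorem theorem1 (R : realType) (K : R) (K_gt0 : 0 < K) :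
  exists c1 c2 : R, [/\ 0 < c1, 0 < c2 &
    forall A : {fset int},
      #|` sumset A A|%fset%:R <= K * #|` A|%fset%:R ->
      exists (A' : {fset int}) (phi : int -> int),
        [/\ (A' `<=` A)%fset,
            c1 * #|` A|%fset%:R <= #|` A'|%fset%:R,
            order_preserving_freiman2_iso (mem A') (fun x => (phi x)%:~R : R)
          & {in A', forall x,
              - (c2 * #|` A'|%fset%:R) <= (phi x)%:~R <= c2 * #|` A'|%fset%:R}]].
Proof.
have [C hC] := ordered_model R (Num.bound K).
exists C.+1%:R^-1, C.+1%:R; split; rewrite ?invr_gt0 ?ltr0n // => A hA.
have [->|A0] := eqVneq A fset0.
  by exists fset0, id; split=> //; rewrite cardfs0 mulr0.
have [|A' [phi [A'A cA' ltP sumP leP]]] := hC A A0.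
  rewrite -(ler_nat R) natrM; apply: le_trans hA _; rewrite ler_wpM2r //.
  exact/ltW/archi_boundP/ltW.
exists A', phi; split=> //.
- rewrite mulrC ler_pdivrMr ?ltr0n // mulrC -natrM ler_nat.
  by apply: leq_trans cA' _; rewrite leq_mul2r leqnSn orbT.
- split=> [a b aA bA|a b c d aA bA cA dA]; first by rewrite ltr_int; apply: ltP.
  rewrite -!intrD; split=> [/intr_inj /(sumP _ _ _ _ aA bA cA dA)//|h].
  by congr (_%:~R); apply/sumP.
move=> x xA; rewrite -ler_norml -intr_norm -natrM [leRHS]pmulrn ler_int.
by apply: le_trans (leP x xA) _; rewrite lez_nat leq_mul2r leqnSn orbT.
Qed.
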